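(* For each non-negative integer $n$, the assignment $t\leftrightarrow \alpha_t$ gives a bijection $T_n\leftrightarrow D_n$ between the set $T_n$ of all reflections of $W$ whose $\infty$-height equals $n$ and the set $D_n$ of all positive roots that strictly dominate exactly $n$ positive roots.
   Context: Coxeter datum. Let $V$ be a real vector space with a symmetric bilinear form $(\,,\,)$. For $A\subseteq V$, $\mathrm{PLC}(A)$ is the set of all (finite) sums $\sum_{a\in A}\lambda_a a$ with all $\lambda_a\ge 0$ and some $\lambda_{a'}>0$. A subset $\Delta\subseteq V$ is a root basis if (C1) $(a,a)=1$ for all $a\in\Delta$, and for distinct $a,b\in\Delta$ either $(a,b)=-\cos(\pi/m_{ab})$ for an integer $m_{ab}=m_{ba}\ge 2$, or $(a,b)\le -1$ (then $m_{ab}=m_{ba}=\infty$); (C2) $0\notin\mathrm{PLC}(\Delta)$. ($\Delta$ may be infinite or linearly dependent.) Fix such a Coxeter datum $(V,\Delta,(\,,\,))$. Let $(W,S)$, $S=\{r_a\mid a\in\Delta\}$, be the Coxeter system in which the $r_a$ are involutions and $r_ar_b$ has order $m_{ab}$; $W$ acts on $V$ (faithfully, preserving the form) by $r_a x=x-2(x,a)a$. Let $\ell$ be its length function, $\Phi=\{wa\mid w\in W,a\in\Delta\}$, $\Phi^+=\Phi\cap\mathrm{PLC}(\Delta)$ (positive roots), $\Phi^-=-\Phi^+$ (negative roots); $\Phi$ is the disjoint union of $\Phi^+$ and $\Phi^-$. Let $T=\bigcup_{w\in W}wSw^{-1}$ (reflections). For $x\in\Phi$, $r_x\in T$ is the element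 acting by $v\mapsto v-2(v,x)x$. For $t\in T$, $\alpha_t$ is the unique positive root with $r_{\alpha_t}=t$. Reflection subgroups. A subgroup $W'$ of $W$ is a reflection subgroup if $W'=\langle W'\cap T\rangle$. For $w\in W$ put $\overline N(w)=\{t\in T\mid \ell(wt)<\ell(w)\}$. For a reflection subgroup $W'$ let $S(W')=\{t\in T\mid \overline N(t)\cap W'=\{t\}\}$ and $\Delta(W')=\{x\in\Phi^+\mid r_x\in S(W')\}$. Then $(W',S(W'))$ is a Coxeter system, with length function $\ell_{(W',S(W'))}$. Put $\Phi(W')=\{x\in\Phi\mid r_x\in W'\}=W'\Delta(W')$, $\Phi^+(W')=\Phi(W')\cap\mathrm{PLC}(\Delta(W'))$, $\Phi^-(W')=-\Phi^+(W')$. $W'$ is a dihedral reflection subgroup if $\#S(W')=2$. Dominance. For $x,y\in\Phi$, $x\ \mathrm{dom}_W\ y$ ($x$ dominates $y$) means $\{w\in W\mid wx\in\Phi^-\}\subseteq\{w\in W\mid wy\in\Phi^-\}$. For $x\in\Phi^+$, $D(x)=\{y\in\Phi^+\mid y\ne x,\ x\ \mathrm{dom}_W\ y\}$, and $D_n=\{x\in\Phi^+\mid \#D(x)=n\}$. Infinity height. Let $\mathscr M$ be the set of maximal (under inclusion) dihedral reflection subgroups of $W$, $\mathscr M_\infty$ the set of infinite members of $\mathscr M$, and $\mathscr M_t=\{W'\in\mathscr M\mid t\in W'\}$ for $t\in T$. For a reflection subgroup $W'$ and $t\in W'\cap T$, $h_{(W',S(W'))}(t)=\min\{\ell_{(W',S(W'))}(w)\mid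 w\in W',\ w\alpha_t\in\Delta(W')\}$. The $\infty$-height of $t\in T$ is $h^\infty(t)=\sum_{W'\in\mathscr M_t\cap\mathscr M_\infty}h_{(W',S(W'))}(t)$ (only finitely many terms are nonzero), and $T_n=\{t\in T\mid h^\infty(t)=n\}$. *)

(* Defs.v *)
From HB Require Import structures.
From mathcomp Require Import all_boot all_order all_algebra.
From mathcomp Require Import all_classical all_reals.
From mathcomp Require Import all_analysis.

Set Implicit Arguments.
Unset Strict Implicit.
Unset Printing Implicit Defensive.

Import Order.TTheory GRing.Theory Num.Theory.

Local Open Scope classical_set_scope.
Local Open Scope card_scope.
Local Open Scope ring_scope.

(* Least element of P; the value is 0 when P is empty. *)
Definition nat_min (P : set nat) : nat :=
  xget 0%N [set k | P k /\ forall j, P j -> (k <= j)%N].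

Section Groups.
Local Open Scope group_scope.
Variable W : groupType.
Implicit Types (A H S : set W) (g w : W).

Definition is_subgroup H : Prop := group_closed [in H].

Definition generated A : set W := smallest is_subgroup A.

Definition has_order g (m : nat) : Prop :=
  [/\ (0 < m)%N, g ^+ m = 1 & forall k, (0 < k < m)%N -> g ^+ k <> 1].

Definition has_infinite_order g : Prop :=
  forall k, (0 < k)%N -> g ^+ k <> 1.

(* Inverses of letters are not allowed in words: S always consists of
   involutions below. *)
Definition word_length S w : nat :=
  nat_min [set k | exists s : seq W,
    [/\ size s = k, forall x, x \in s -> S x & w = \prod_(x <- s) x]].

End Groups.

Section RootBasis.
Variables (R : realType) (V : lmodType R) (B : {symmetric V}) (Delta : set V).
Implicit Types (A : set V) (a b x y v : V).

Definition PLC A : set V :=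
  [set x | exists (s : seq V) (lam : V -> R),
    [/\ uniq s, forall a, a \in s -> A a, forall a, a \in s -> 0 <= lam a,
        exists2 a, a \in s & 0 < lam a
      & x = \sum_(a <- s) lam a *: a]].

(* For distinct a, b in a root basis: m_ab = m, resp. m_ab = oo. *)
Definition m_finite a b (m : nat) : Prop :=
  (2 <= m)%N /\ B a b = - cos (pi / m%:R).

Definition m_infinite a b : Prop := B a b <= -1.

Definition root_basis : Prop :=
  [/\ forall a, Delta a -> B a a = 1,
      forall a b, Delta a -> Delta b -> a <> b ->
        (exists m, m_finite a b m) \/ m_infinite a b
    & ~ PLC Delta 0].

(* gen a is the Coxeter generator r_a; gen is irrelevant outside Delta. *)
Variables (W : groupType) (gen : V -> W) (act : W -> V -> V).
Implicit Types (w t : W) (H K : set W).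

Definition simple_reflections : set W := gen @` Delta.
Local Notation S := simple_reflections.

(* The last clause is the universal property of the presentation
   < S | r_a^2 = 1, (r_a r_b)^(m_ab) = 1 for m_ab finite >. *)
Definition coxeter_system : Prop :=
  [/\ forall a, Delta a -> has_order (gen a) 2,
      forall a b m, Delta a -> Delta b -> a <> b ->
        m_finite a b m -> has_order (gen a * gen b)%g m,
      forall a b, Delta a -> Delta b -> a <> b ->
        m_infinite a b -> has_infinite_order (gen a * gen b)%g,
      generated S = setT
    & forall (G : groupType) (f : V -> G),
        (forall a, Delta a -> (f a * f a)%g = 1%g) ->
        (forall a b m, Delta a -> Delta b -> a <> b ->
           m_finite a b m -> ((f a * f b) ^+ m)%g = 1%g) ->
        exists phi : {multiplicative W -> G},
          forall a, Delta a -> phi (gen a) = f a].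

Definition acts_by_reflections : Prop :=
  [/\ forall v, act 1%g v = v,
      forall w w' v, act (w * w')%g v = act w (act w' v)
    & forall a v, Delta a -> act (gen a) v = v - (2 * B v a) *: a].

Definition len : W -> nat := word_length S.

Definition Phi : set V := [set x | exists w a, Delta a /\ x = act w a].
Definition Phi_pos : set V := Phi `&` PLC Delta.
Definition Phi_neg : set V := [set x | Phi_pos (- x)].

Definition T : set W :=
  [set t | exists w s, S s /\ t = (w * s * w^-1)%g].

(* r_x for a root x.  The action is faithful, so at most one element
   qualifies. *)
Definition refl x : W :=
  xget 1%g [set t | T t /\ forall v, act t v = v - (2 * B v x) *: x].

(* alpha_t for a reflection t: the unique positive root x with r_x = t. *)
Definition alpha t : V := xget 0 [set x | Phi_pos x /\ refl x = t].

Definition reflection_subgroup H : Prop :=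
  is_subgroup H /\ H = generated (H `&` T).

Definition Nbar w : set W := [set t | T t /\ (len (w * t)%g < len w)%N].

Definition canonical_generators H : set W :=
  [set t | T t /\ Nbar t `&` H = [set t]].

Definition canonical_roots H : set V :=
  [set x | Phi_pos x /\ canonical_generators H (refl x)].

Definition dihedral_reflection_subgroup H : Prop :=
  reflection_subgroup H /\ canonical_generators H #= `I_2.

Definition maximal_dihedral : set (set W) :=
  [set H | dihedral_reflection_subgroup H /\
     forall K, dihedral_reflection_subgroup K -> H `<=` K -> K = H].

Definition dominates x y : Prop :=
  [set w | Phi_neg (act w x)] `<=` [set w | Phi_neg (act w y)].

Definition D x : set V := [set y | [/\ Phi_pos y, y <> x & dominates x y]].

Definition D_ (n : nat) : set V := [set x | Phi_pos x /\ D x #= `I_n].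

Definition height H t : nat :=
  nat_min [set k | exists w, [/\ H w, canonical_roots H (act w (alpha t))
                               & k = word_length (canonical_generators H) w]].

(* The sum has only finitely many nonzero terms. *)
Definition infinity_height t : nat :=
  (\big[addn/0%N]_(H \in [set H | [/\ maximal_dihedral H, infinite_set H & H t]])
     height H t)%N.

Definition T_ (n : nat) : set W := [set t | T t /\ infinity_height t = n].

End RootBasis.

(* Main.v *)
(** Two distinct reflections r_x, r_y lie in a unique maximal dihedral
    reflection subgroup, the one generated by the reflections whose roots lie in
    the plane of x and y.  If x strictly dominates y this subgroup is infinite,
    so the set D(x) is partitioned by the infinite maximal dihedral subgroups M
    containing r_x, and it suffices to show that the roots of M strictly
    dominated by x number h_M(r_x).  Let a and b be the canonical roots of M.
    If x is neither of them, x dominates a or b, say a; then r_a maps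
    the remaining roots of M dominated by x bijectively onto those dominated by
    r_a x, whereas reflecting in any canonical root lowers the count by at most
    one.  So the count is the least number of canonical reflections that take x
    to a or b. *)

Require Import Defs.
From mathcomp Require Import all_boot all_order all_algebra.
From mathcomp Require Import finmap.
From mathcomp Require Import all_classical all_reals.
From mathcomp Require Import all_analysis.
From mathcomp Require Import ring lra zify.

Set Implicit Arguments.
Unset Strict Implicit.
Unset Printing Implicit Defensive.

Import Order.TTheory GRing.Theory Num.Theory.

Local Open Scope classical_set_scope.
Local Open Scope card_scope.
Local Open Scope ring_scope.

(** Since [Delta] may be infinite and linearly dependent, roots have no coefficients over [Delta] to
    compare. Signs are handled through the cone [PLC Delta] alone, which never contains both v and
    -v; contradictions come from combinations with nonpositive coefficients. Coordinates return
    inside a dihedral subgroup, because two distinct positive roots are linearly independent.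
    Canonical generators are defined by lengths in W, dominance by signs of roots. The two meet in
    [simple_root], which restates canonicity as a sign condition: r_c keeps positive every positive
    root of H other than c. Finiteness of inversion sets enters twice. It makes D(x) finite, since
    r_x makes x, hence every root dominated by x, negative. It also explains why an infinite H
    forces domination of a canonical root: otherwise two inversion sets would cover all positive
    roots of H. *)

Lemma nat_minP (P : set nat) : P !=set0 ->
  P (nat_min P) /\ forall j, P j -> (nat_min P <= j)%N.
Proof.
move=> [k Pk]; rewrite /nat_min; apply: (@xgetPex _ 0%N [set k | P k /\ _]).
have exP : exists k, `[< P k >] by exists k; apply/asboolP.
case: (ex_minnP exP) => m /asboolP Pm mmin.
by exists m; split=> // j Pj; apply: mmin; apply/asboolP.
Qed.

Lemma nat_min_eq (P : set nat) k :
  P k -> (forall j, P j -> (k <= j)%N) -> nat_min P = k.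
Proof.
move=> Pk kmin; have [] := nat_minP (ex_intro _ k Pk) => Pm mmin.
by apply/eqP; rewrite eqn_leq mmin// kmin.
Qed.

Lemma image_seq (T U : eqType) (f : T -> U) (A : set T) (s : seq U) :
  (forall x, x \in s -> (f @` A) x) ->
  exists s', (forall x, x \in s' -> A x) /\ s = map f s'.
Proof.
elim: s => [|x s IHs] As; first by exists [::].
have [|s' [As' ->]] := IHs; first by move=> y ys; apply: As; rewrite inE ys orbT.
have [y Ay <-] := As _ (mem_head _ _).
exists (y :: s'); split=> // z; rewrite inE => /predU1P[->//|]; exact: As'.
Qed.

Lemma card_eq2P (U : choiceType) (A : set U) :
  A #= `I_2 <-> exists s t, s <> t /\ A = [set s; t].
Proof.
split=> [/card_set_bijP[f [fI finj fsurj]]|[s [t [st ->]]]].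
  have [s As fs] := fsurj 0%N (erefl : (0 < 2)%N).
  have [t At ft] := fsurj 1%N (erefl : (1 < 2)%N).
  exists s, t; split; first by move=> e; move: fs; rewrite e ft.
  apply/seteqP; split=> [u Au|_ [->|->]//] /=.
  have : (f u < 2)%N by exact: fI.
  case fu : (f u) => [|[|//]] _; [left|right]; apply: finj; rewrite ?inE//.
    by rewrite fu fs.
  by rewrite fu ft.
apply/card_set_bijP; exists (fun u => if u == s then 0%N else 1%N); split.
- by move=> u _ /=; case: ifP.
- have /eqP/negPf ts : t <> s by move=> /esym.
  by move=> u v; rewrite !inE => -[]-> []->; rewrite ?eqxx ?ts.
- move=> [|[|//]] _ /=; first by exists s; [left|rewrite eqxx].
  by exists t; [right|case: eqP => // /esym].
Qed.

Lemma card_fset_set_inj (T U : choiceType) (f : T -> U) (A : set T) (A' : set U) :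
  injective f -> finite_set A -> finite_set A' -> (forall x, A x -> A' (f x)) ->
  (#|` fset_set A| <= #|` fset_set A'|)%fset%N.
Proof.
move=> finj Afin A'fin AA'.
have -> : (#|` fset_set A| = #|` f @` fset_set A|)%fset by rewrite card_imfset.
rewrite -fset_set_image//; apply: fsubset_leq_card; rewrite -fset_set_sub//; last exact: finite_image.
by move=> _ [x /AA' ? <-].
Qed.

(** Counting by fibres of [f]. It serves to add up the heights, each of which is the size of one
    fibre. *)
Lemma sum_count_undup_map (T U : eqType) (f : T -> U) (s : seq T) :
  (\sum_(u <- undup (map f s)) count (fun y => f y == u) s = size s)%N.
Proof.
under eq_bigr do rewrite -sum1_count.
rewrite (exchange_big_dep xpredT)//= -sum1_size big_seq [RHS]big_seq.
apply: eq_bigr => y ys; rewrite sum1_count.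
rewrite (eq_count (a2 := pred1 (f y))); last by move=> u /=; rewrite eq_sym.
by rewrite count_uniq_mem ?undup_uniq// mem_undup map_f.
Qed.

(** * Words in a group generated by involutions *)

Section GroupWords.
Local Open Scope group_scope.
Variable W : groupType.
Implicit Types (A H : set W) (w x : W).

Lemma subgroup1 H : is_subgroup H -> H 1.
Proof. by case; rewrite inE. Qed.

Lemma subgroupV H x : is_subgroup H -> H x -> H x^-1.
Proof. by move=> /group_closedV HV Hx; have := HV x; rewrite !inE; apply. Qed.

Lemma subgroupM H x y : is_subgroup H -> H x -> H y -> H (x * y).
Proof.
by move=> /group_closedM HM Hx Hy; have := HM x y; rewrite !inE; apply.
Qed.

Lemma subgroupI H : H 1 -> (forall x y, H x -> H y -> H (x * y)) ->
  (forall x, H x -> H x^-1) -> is_subgroup H.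
Proof.
by move=> H1 HM HV; split=> [|x y]; rewrite !inE// => Hx /HV; apply: HM.
Qed.

Lemma subgroup_prod H (T : eqType) (f : T -> W) (s : seq T) : is_subgroup H ->
  (forall i, i \in s -> H (f i)) -> H (\prod_(i <- s) f i).
Proof.
move=> HH Hs; rewrite big_seq; elim/big_ind: _ => //; first exact: subgroup1.
by move=> x y; apply: subgroupM.
Qed.

Lemma generated_subgroup A : is_subgroup (generated A).
Proof.
apply: subgroupI => [|x y Ax Ay|x Ax] K [KK AK].
- exact: subgroup1.
- by apply: subgroupM => //; [apply: Ax|apply: Ay].
- by apply: subgroupV => //; apply: Ax.
Qed.

Lemma sub_generated A : A `<=` generated A.
Proof. exact: sub_gen_smallest. Qed.

Lemma generated_sub A H : is_subgroup H -> A `<=` H -> generated A `<=` H.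
Proof. exact: smallest_sub. Qed.

Definition word_of A (s : seq W) w :=
  (forall x, x \in s -> A x) /\ w = \prod_(x <- s) x.

Variable A : set W.
Hypothesis A_inv : forall x, A x -> x * x = 1.

Lemma generatedP w : generated A w -> exists s, word_of A s w.
Proof.
apply: (@generated_sub A [set w | exists s, word_of A s w]); last first.
  by move=> x Ax; exists [:: x]; split; [move=> y; rewrite inE => /eqP->|rewrite big_seq1].
apply: subgroupI => [|x y [s [As ->]] [s' [As' ->]]|x [s [As ->]]].
- by exists [::]; split=> //; rewrite big_nil.
- exists (s ++ s'); split; last by rewrite big_cat.
  by move=> z; rewrite mem_cat => /orP[/As|/As'].
- exists (rev s); split; first by move=> z; rewrite mem_rev => /As.
  elim: s As => [|z s IHs] As; first by rewrite !big_nil invg1.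
  rewrite rev_cons -cats1 big_cat big_seq1 big_cons invgM IHs; last first.
    by move=> y ys; apply: As; rewrite inE ys orbT.
  by congr (_ * _); apply: mulg1_eq; apply/A_inv/As/mem_head.
Qed.

Lemma word_lengthP w : generated A w ->
  (exists2 s, word_of A s w & size s = word_length A w) /\
  forall s, word_of A s w -> (word_length A w <= size s)%N.
Proof.
move=> /generatedP[s [As ws]]; rewrite /word_length.
have [|] := @nat_minP [set k | exists s : seq W,
    [/\ size s = k, forall x, x \in s -> A x & w = \prod_(x <- s) x]].
  by exists (size s), s.
move=> [s1 [sz As1 ws1]] H; split; first by exists s1.
by move=> s2 [As2 ws2]; apply: H; exists s2.
Qed.

Lemma word_lengthMr w x : generated A w -> A x ->
  (word_length A (w * x) <= (word_length A w).+1)%N.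
Proof.
move=> Aw Ax; have [[s [As ws] <-] _] := word_lengthP Aw.
have Awx : generated A (w * x).
  by apply: (subgroupM (generated_subgroup A)) => //; exact: sub_generated.
have [_ /(_ (rcons s x))] := word_lengthP Awx; rewrite size_rcons; apply.
split; last by rewrite -cats1 big_cat big_seq1 ws.
by move=> y; rewrite mem_rcons inE => /predU1P[->|/As].
Qed.

Lemma word_length_descent w : generated A w -> w <> 1 ->
  exists2 x, A x & (word_length A (w * x) < word_length A w)%N.
Proof.
move=> Aw w1; have [[s [As ws] <-] _] := word_lengthP Aw.
case/lastP: s As ws => [|s x] As ws; first by rewrite big_nil in ws.
have Ax : A x by apply: As; rewrite mem_rcons mem_head.
have Awx : generated A (w * x).
  by apply: (subgroupM (generated_subgroup A)) => //; exact: sub_generated.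
exists x => //; have [_ /(_ s)] := word_lengthP Awx.
rewrite size_rcons ltnS; apply; split.
  by move=> y ys; apply: As; rewrite mem_rcons inE ys orbT.
by rewrite ws -cats1 big_cat big_seq1 -mulgA A_inv// mulg1.
Qed.

End GroupWords.

(** * Positive cones and planes *)

Section Cones.
Variables (R : realType) (V : lmodType R).
Implicit Types (A : set V) (x y : V).

(** The induction principle for cones. As [P] need not contain 0, the term with a positive
    coefficient is set aside first; the remaining sum may vanish. *)
Lemma PLC_min A (P : set V) :
  A `<=` P -> (forall x y, P x -> P y -> P (x + y)) ->
  (forall (k : R) x, 0 < k -> P x -> P (k *: x)) -> PLC A `<=` P.
Proof.
move=> AP PD PZ x [s [lam [us As lam0 [a0 a0s la0] ->]]].
suff H (t : seq V) : (forall a, a \in t -> P a /\ 0 <= lam a) ->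
    \sum_(a <- t) lam a *: a = 0 \/ P (\sum_(a <- t) lam a *: a).
  rewrite (perm_big _ (perm_to_rem a0s)) big_cons /=.
  have Pa0 : P (lam a0 *: a0) by apply: PZ => //; apply/AP/As.
  have [|->|Pt] := H (rem a0 s); [|by rewrite addr0|exact: PD].
  by move=> a /mem_rem ain; split; [apply/AP/As|exact: lam0].
elim: t => [|a t IHt] Pt; first by left; rewrite big_nil.
have [Pa la] := Pt a (mem_head _ _); rewrite big_cons.
have [|->|Pt'] := IHt; first by move=> b bt; apply: Pt; rewrite inE bt orbT.
  rewrite addr0; move: la; rewrite le_eqVlt => /predU1P[<-|la]; [by left; rewrite scale0r|right; exact: PZ].
move: la; rewrite le_eqVlt => /predU1P[<-|la]; right; first by rewrite scale0r add0r.
by apply: PD => //; apply: PZ.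
Qed.

Lemma sub_PLC A : A `<=` PLC A.
Proof.
move=> a Aa; exists [:: a], (fun=> 1); split=> //.
- by move=> b; rewrite inE => /eqP->.
- by exists a; rewrite ?mem_head ?ltr01.
- by rewrite big_seq1 scale1r.
Qed.

Lemma PLCZ A (k : R) x : 0 < k -> PLC A x -> PLC A (k *: x).
Proof.
move=> k0 [s [lam [us As lam0 [a as_ la] ->]]].
exists s, (fun a => k * lam a); split=> //.
- by move=> b bs; rewrite mulr_ge0 ?lam0 ?ltW.
- by exists a; rewrite // mulr_gt0.
- by rewrite scaler_sumr; apply: eq_bigr => b _; rewrite scalerA.
Qed.

Lemma PLCD A x y : PLC A x -> PLC A y -> PLC A (x + y).
Proof.
move=> [s [f [us As f0 [a as_ fa] ->]]] [t [g [ut At g0 [b bt gb] ->]]].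
have sumE (r : seq V) (h : V -> R) (u := undup (s ++ t)) : uniq r -> {subset r <= u} ->
    \sum_(a <- r) h a *: a = \sum_(a <- u) (if a \in r then h a else 0) *: a.
  move=> ur ru; rewrite [RHS](eq_bigr (fun a => if a \in r then h a *: a else 0)).
    rewrite -big_mkcond -big_filter; apply: perm_big; apply: uniq_perm => //.
      by rewrite filter_uniq ?undup_uniq.
    by move=> c; rewrite mem_filter; case: (boolP (c \in r)) => // /ru ->.
  by move=> c _; case: ifP => //; rewrite scale0r.
exists (undup (s ++ t)), (fun a => (if a \in s then f a else 0) + (if a \in t then g a else 0)).
split.
- exact: undup_uniq.
- by move=> c; rewrite mem_undup mem_cat => /orP[/As|/At].
- by move=> c _; apply: addr_ge0; case: ifP => //; [exact: f0|exact: g0].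
- exists a; first by rewrite mem_undup mem_cat as_.
  by rewrite as_; apply: ltr_wpDr => //; case: ifP => //; exact: g0.
- rewrite (sumE s f) ?(sumE t g)//.
  + by rewrite -big_split; apply: eq_bigr => c _; rewrite scalerDl.
  + by move=> c ct; rewrite mem_undup mem_cat ct orbT.
  + by move=> c cs; rewrite mem_undup mem_cat cs.
Qed.

Lemma PLC_sub A A' : A `<=` A' -> PLC A `<=` PLC A'.
Proof.
move=> AA'; apply: PLC_min; [|exact: PLCD|exact: PLCZ].
exact: subset_trans (@sub_PLC A').
Qed.

Lemma PLC_comb A (p q : R) x y : 0 <= p -> 0 <= q -> PLC A x -> PLC A y ->
  p *: x + q *: y = 0 \/ PLC A (p *: x + q *: y).
Proof.
rewrite le_eqVlt => /predU1P[<-|p0]; rewrite le_eqVlt => /predU1P[<-|q0] Ax Ay;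
  rewrite ?scale0r ?add0r ?addr0; [by left|right..].
- exact: PLCZ.
- exact: PLCZ.
- by apply: PLCD; exact: PLCZ.
Qed.

Lemma combD (a b : V) (p q p' q' : R) :
  p *: a + q *: b + (p' *: a + q' *: b) = (p + p') *: a + (q + q') *: b.
Proof. by rewrite addrACA -!scalerDl. Qed.

Lemma combZ (a b : V) (k p q : R) :
  k *: (p *: a + q *: b) = (k * p) *: a + (k * q) *: b.
Proof. by rewrite scalerDr !scalerA. Qed.

Lemma combN (a b : V) (p q : R) :
  - (p *: a + q *: b) = (- p) *: a + (- q) *: b.
Proof. by rewrite opprD !scaleNr. Qed.

Definition plane (a b : V) : set V := [set v | exists p q : R, v = p *: a + q *: b].

Lemma planeD a b v w : plane a b v -> plane a b w -> plane a b (v + w).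
Proof. by move=> [p [q ->]] [p' [q' ->]]; rewrite combD; do 2 eexists. Qed.

Lemma planeZ a b k v : plane a b v -> plane a b (k *: v).
Proof. by move=> [p [q ->]]; rewrite combZ; do 2 eexists. Qed.

Lemma plane0 a b : plane a b 0.
Proof. by exists 0, 0; rewrite !scale0r addr0. Qed.

Lemma plane_l a b : plane a b a.
Proof. by exists 1, 0; rewrite scale0r scale1r addr0. Qed.

Lemma plane_r a b : plane a b b.
Proof. by exists 0, 1; rewrite scale0r scale1r add0r. Qed.

Lemma plane_trans a b c d v :
  plane a b c -> plane a b d -> plane c d v -> plane a b v.
Proof. by move=> ac ad [p [q ->]]; apply: planeD; exact: planeZ. Qed.

End Cones.

(* [chebyshev c k] is U_(k-1)(c), Chebyshev polynomials of the second kind; for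
   c = - (a, b) these are the coefficients, in the basis a, b, of the roots of
   the dihedral group generated by r_a and r_b. *)
Fixpoint chebyshev (R : realType) (c : R) (k : nat) : R :=
  if k is k1.+1 then
    if k1 is k2.+1 then 2 * c * chebyshev c k1 - chebyshev c k2 else 1
  else 0.

Section Chebyshev.
Variable R : realType.
Implicit Type c : R.

Lemma chebyshevSS c k :
  chebyshev c k.+2 = 2 * c * chebyshev c k.+1 - chebyshev c k.
Proof. by []. Qed.

Lemma chebyshev_cos (x : R) k : chebyshev (cos x) k * sin x = sin (k%:R * x).
Proof.
have [] : chebyshev (cos x) k * sin x = sin (k%:R * x) /\
    chebyshev (cos x) k.+1 * sin x = sin (k.+1%:R * x); last by [].
elim: k => [|k [IH1 IH2]]; first by rewrite /= !mul0r sin0 !mul1r.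
split=> //; rewrite chebyshevSS mulrBl -(mulrA (2 * _)) IH2 IH1.
have -> : k.+2%:R * x = k.+1%:R * x + x by rewrite -[k.+2]addn1 natrD mulrDl mul1r.
have -> : k%:R * x = k.+1%:R * x - x.
  by rewrite -[k.+1]addn1 natrD mulrDl mul1r addrK.
by rewrite sinB sinD; ring.
Qed.

(** The angle k pi / m stays in [0, pi], where the sine is nonnegative, and the factor sin (pi / m)
    is positive. *)
Lemma chebyshev_cos_ge0 m k : (1 < m)%N -> (k <= m)%N ->
  0 <= chebyshev (cos (pi / m%:R) : R) k.
Proof.
move=> m1 km; set x : R := pi / m%:R.
have m0 : 0 < m%:R :> R by rewrite ltr0n; lia.
have sx : 0 < sin x.
  apply: sin_gt0_pi; rewrite divr_gt0 ?pi_gt0//=.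
  by rewrite ltr_pdivrMr// ltr_pMr ?pi_gt0// ltr1n.
rewrite -(pmulr_lge0 _ sx) chebyshev_cos; apply: sin_ge0_pi.
rewrite mulr_ge0 ?divr_ge0 ?pi_ge0 ?ler0n//=.
by rewrite /x mulrCA -[leRHS]mulr1 ler_pM2l ?pi_gt0// ler_pdivrMr// mul1r ler_nat.
Qed.

(** Nonnegativity alone does not pass through the recurrence; together with monotonicity in [k] it
    does. *)
Lemma chebyshev_ge0 c k : 1 <= c -> 0 <= chebyshev c k.
Proof.
move=> c1.
suff [] : 0 <= chebyshev c k /\ chebyshev c k <= chebyshev c k.+1 by [].
elim: k => [|k [IH1 IH2]]; first by rewrite /= lexx ler01.
split; first exact: le_trans IH2.
by rewrite chebyshevSS; nra.
Qed.

End Chebyshev.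

(** * Positive and negative roots *)

Section RootSystem.
Variables (R : realType) (V : lmodType R) (B : {symmetric V}) (Delta : set V).
Variables (W : groupType) (gen : V -> W) (act : W -> V -> V).
Hypothesis hDelta : root_basis B Delta.
Hypothesis hW : coxeter_system B Delta gen.
Hypothesis hact : acts_by_reflections B Delta gen act.
Implicit Types (a b c d x y z v : V) (u w t : W) (H K : set W).

Local Notation S := (simple_reflections Delta gen).
Local Notation len := (len Delta gen).
Local Notation Phi := (Phi Delta act).
Local Notation Phi_pos := (Phi_pos Delta act).
Local Notation Phi_neg := (Phi_neg Delta act).
Local Notation T := (T Delta gen).
Local Notation refl := (refl B Delta gen act).

Lemma BC x y : B x y = B y x.
Proof. by rewrite hermC expr0 mul1r. Qed.

Lemma BDl x y z : B (x + y) z = B x z + B y z. Proof. exact: linearDl. Qed.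
Lemma BZl k x z : B (k *: x) z = k * B x z. Proof. exact: linearZl_LR. Qed.
Lemma BNl x z : B (- x) z = - B x z. Proof. exact: linearNl. Qed.
Lemma BDr x y z : B z (x + y) = B z x + B z y. Proof. by rewrite linearDr. Qed.
Lemma BZr k x z : B z (k *: x) = k * B z x. Proof. by rewrite linearZr_LR. Qed.
Lemma BNr x z : B z (- x) = - B z x. Proof. by rewrite linearNr. Qed.
Definition BE := (BDl, BZl, BNl, BDr, BZr, BNr).

Lemma simple_norm a : Delta a -> B a a = 1.
Proof. by case: hDelta => h _ _; exact: h. Qed.

Lemma PLC_neq0 : ~ PLC Delta 0.
Proof. by case: hDelta. Qed.

Lemma PLC_opp x : PLC Delta x -> ~ PLC Delta (- x).
Proof. by move=> xP /(PLCD xP); rewrite subrr; exact: PLC_neq0. Qed.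

Lemma simple_B_le0 a b : Delta a -> Delta b -> a <> b -> B a b <= 0.
Proof.
move=> Da Db ab; case: hDelta => _ /(_ a b Da Db ab)[[m [m2 ->]]|h] _; last first.
  by apply: le_trans h _; rewrite oppr_le0 ler01.
rewrite oppr_le0; apply: cos_ge0_pihalf.
have m0 : 0 < m%:R :> R by rewrite ltr0n; lia.
apply/andP; split; first by apply: le_trans (divr_ge0 (pi_ge0 R) (ltW m0)); rewrite oppr_le0 divr_ge0 ?pi_ge0.
by rewrite ler_pM2l ?pi_gt0// lef_pV2 ?posrE// ler_nat.
Qed.

Lemma gen_sq a : Delta a -> (gen a * gen a)%g = 1%g.
Proof. by case: hW => h _ _ _ _ /h[_ h2 _]; rewrite -h2 expg2. Qed.

Lemma S_inv s : S s -> (s * s)%g = 1%g.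
Proof. by move=> [a Da <-]; exact: gen_sq. Qed.

Lemma S_gen w : generated S w.
Proof. by case: hW => _ _ _ -> _. Qed.

Lemma W_ind (P : W -> Prop) : P 1%g ->
  (forall a w, Delta a -> P w -> P (gen a * w)%g) -> forall w, P w.
Proof.
move=> P1 PM w; have [s [sS ->]] := generatedP S_inv (S_gen w).
elim: s sS => [|x s IHs] sS; first by rewrite big_nil.
rewrite big_cons; have [a Da <-] := sS _ (mem_head _ _); apply: PM => //.
by apply: IHs => y ys; apply: sS; rewrite inE ys orbT.
Qed.

Lemma act1 v : act 1%g v = v. Proof. by case: hact. Qed.

Lemma actM w w' v : act (w * w')%g v = act w (act w' v).
Proof. by case: hact. Qed.

Lemma act_gen a v : Delta a -> act (gen a) v = v - (2 * B v a) *: a.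
Proof. by case: hact => _ _; apply. Qed.

Lemma actK w : cancel (act w) (act w^-1%g).
Proof. by move=> v; rewrite -actM mulVg act1. Qed.

Lemma actVK w : cancel (act w^-1%g) (act w).
Proof. by move=> v; rewrite -actM mulgV act1. Qed.

Lemma act_inj w : injective (act w).
Proof. exact: can_inj (actK w). Qed.

Lemma actD w x y : act w (x + y) = act w x + act w y.
Proof.
elim/W_ind: w x y => [|a w Da IHw] x y; first by rewrite !act1.
by rewrite !actM IHw !act_gen// BDl mulrDr scalerDl opprD addrACA.
Qed.

Lemma actZ w (k : R) x : act w (k *: x) = k *: act w x.
Proof.
elim/W_ind: w x => [|a w Da IHw] x; first by rewrite !act1.
by rewrite !actM IHw !act_gen// BZl scalerBr scalerA mulrCA.
Qed.

Lemma actN w x : act w (- x) = - act w x.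
Proof. by rewrite -scaleN1r actZ scaleN1r. Qed.

Lemma act_comb w (p q : R) x y :
  act w (p *: x + q *: y) = p *: act w x + q *: act w y.
Proof. by rewrite actD !actZ. Qed.

Lemma actB w x y : B (act w x) (act w y) = B x y.
Proof.
elim/W_ind: w x y => [|a w Da IHw] x y; first by rewrite !act1.
by rewrite !actM !act_gen// !BE simple_norm// [B a _]BC IHw; ring.
Qed.

Lemma Phi_norm x : Phi x -> B x x = 1.
Proof. by move=> [w [a [Da ->]]]; rewrite actB simple_norm. Qed.

Lemma Phi_act w x : Phi x -> Phi (act w x).
Proof. by move=> [w' [a [Da ->]]]; exists (w * w')%g, a; rewrite actM. Qed.

Lemma Phi_simple a : Delta a -> Phi a.
Proof. by exists 1%g, a; rewrite act1. Qed.

Lemma act_gen_self a : Delta a -> act (gen a) a = - a.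
Proof. by move=> Da; rewrite act_gen// simple_norm// mulr1 scaler_nat mulr2n opprD addrA subrr add0r. Qed.

Lemma PhiN x : Phi x -> Phi (- x).
Proof.
move=> [w [a [Da ->]]]; exists (w * gen a)%g, a; split => //.
by rewrite actM act_gen_self// actN.
Qed.

Lemma Phi_negP x : Phi_neg x <-> Phi x /\ PLC Delta (- x).
Proof.
rewrite /Defs.Phi_neg /= /Defs.Phi_pos; split=> -[h1 h2]; split=> //.
  by rewrite -[x]opprK; exact: PhiN.
exact: PhiN.
Qed.

Lemma Phi_pos_neg x : Phi_pos x -> ~ Phi_neg x.
Proof. by move=> [_ xP] [_ xN]; exact: PLC_opp xN. Qed.

Lemma Phi_posN x : Phi_pos x -> Phi_neg (- x).
Proof. by rewrite /Defs.Phi_neg /= opprK. Qed.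

Lemma simple_pos a : Delta a -> Phi_pos a.
Proof. by move=> Da; split; [exact: Phi_simple|exact: sub_PLC]. Qed.

(** * Alternating words in two simple reflections and the sign of a root *)

Fixpoint altw a b (k : nat) : W :=
  if k is k'.+1 then (altw b a k' * gen a)%g else 1%g.

Lemma altwS a b k :
  altw a b k.+1 = (gen (if odd k then b else a) * altw a b k)%g.
Proof.
elim: k a b => [|k IHk] a b; first by rewrite /= mulg1 mul1g.
have -> : altw a b k.+2 = (altw b a k.+1 * gen a)%g by [].
by rewrite IHk -mulgA /=; case: (odd k).
Qed.

Lemma altw_add a b j k :
  altw a b (j + k) = ((if odd k then altw b a j else altw a b j) * altw a b k)%g.
Proof.
elim: k a b => [|k IHk] a b; first by rewrite addn0 mulg1.
rewrite addnS /= IHk mulgA; congr (_ * _ * _)%g.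
by case: (odd k).
Qed.

Lemma altw_pow a b k : altw b a k.*2 = ((gen a * gen b) ^+ k)%g.
Proof.
elim: k => [//|k IHk]; rewrite doubleS expgSr -IHk /=.
by rewrite mulgA.
Qed.

Lemma altw_inv a b k : Delta a -> Delta b ->
  ((if odd k then altw a b k else altw b a k) * altw a b k)%g = 1%g.
Proof.
move=> Da Db; elim: k a b Da Db => [|k IHk] a b Da Db; first by rewrite mulg1.
have -> : (if odd k.+1 then altw a b k.+1 else altw b a k.+1) =
    (gen a * (if odd k then altw b a k else altw a b k))%g.
  by rewrite !altwS /=; case: (odd k).
rewrite [X in (_ * X)%g]/= -!mulgA [X in (_ * X)%g]mulgA IHk// mul1g.
exact: gen_sq.
Qed.

(** The braid relation: the alternating product of 2m letters splits into two halves of m letters,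
    and the inverse of an alternating product is its reversal, again alternating. Which half ends in
    which letter depends on the parity of [m]. *)
Lemma altw_swap a b m : Delta a -> Delta b ->
  ((gen a * gen b) ^+ m)%g = 1%g -> altw a b m = altw b a m.
Proof.
move=> Da Db; rewrite -altw_pow -addnn altw_add => h.
have hi := altw_inv m Da Db; have hj := altw_inv m Db Da.
have : (if odd m then altw a b m else altw b a m) = (if odd m then altw b a m else altw a b m).
  apply: (@mulIg _ (altw b a m)).
  by rewrite h hj.
by case: (odd m).
Qed.

(** Letting the rightmost letter act on [b] leaves a shorter alternating word acting on [a] and,
    after one change of sign, a word two letters shorter acting on [b]. This is the Chebyshev
    recurrence at - (a, b). *)
Lemma act_altw a b k : Delta a -> Delta b ->
  let z := if odd k then a else b in let z' := if odd k then b else a in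
  act (altw a b k) b =
    chebyshev (- B a b) k.+1 *: z + chebyshev (- B a b) k *: z'.
Proof.
move=> Da Db; set f := chebyshev _.
have step n x y : Delta x -> Delta y -> B x y = B a b ->
    act (altw x y n.+2) y = (2 * - B a b) *: act (altw y x n.+1) x - act (altw x y n) y.
  move=> Dx Dy Bxy; rewrite [altw x y _]/= -/(altw y x n.+1) actM (act_gen y)//.
  rewrite BC Bxy actD actN actZ addrC mulrN scaleNr; congr (_ + _).
  by rewrite /= actM act_gen_self// actN.
have [] : (forall x y, Delta x -> Delta y -> B x y = B a b ->
  act (altw x y k) y = f k.+1 *: (if odd k then x else y) + f k *: (if odd k then y else x)) /\
  (forall x y, Delta x -> Delta y -> B x y = B a b ->
  act (altw x y k.+1) y =
    f k.+2 *: (if odd k then y else x) + f k.+1 *: (if odd k then x else y)); last first.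
  by move=> h _; exact: h.
elim: k => [|k [IH1 IH2]].
  split=> x y Dx Dy Bxy; first by rewrite /= act1 scale1r scale0r addr0.
  have -> : f 2 = - (2 * B a b) by rewrite /f chebyshevSS /= mulr1 subr0 mulrN.
  by rewrite /= mul1g act_gen// BC Bxy addrC scale1r scaleNr.
split=> x y Dx Dy Bxy; first by rewrite IH2//=; case: (odd k).
rewrite step// IH1// IH2 ?(BC y) //.
rewrite [f k.+3]chebyshevSS -/f.
rewrite combZ combN combD /=.
by case: (odd k) => /=; congr (_ *: _ + _ *: _); rewrite chebyshevSS.
Qed.

Lemma len_genM w a : Delta a -> (len (w * gen a)%g <= (len w).+1)%N.
Proof. by move=> Da; apply: (word_lengthMr S_inv); [exact: S_gen|exists a]. Qed.

Lemma len_descent w : w <> 1%g -> exists2 a, Delta a & (len (w * gen a)%g < len w)%N.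
Proof.
move=> w1; have [_ [a Da <-] h] := word_length_descent S_inv (S_gen w) w1.
by exists a.
Qed.

Lemma genK a w : Delta a -> (w * gen a * gen a)%g = w.
Proof. by move=> Da; rewrite -mulgA gen_sq// mulg1. Qed.

Lemma len_altw u a b k : Delta a -> Delta b -> (len (u * altw a b k)%g <= len u + k)%N.
Proof.
elim: k a b => [|k IHk] a b Da Db; first by rewrite mulg1 addn0.
rewrite /= mulgA addnS; apply: leq_trans (len_genM _ Da) _.
by rewrite ltnS IHk.
Qed.

(* v is the shortest element of w <r_a, r_b>. *)
Lemma strip_altw n w a b : Delta a -> Delta b -> (len w <= n)%N ->
  (len (w * gen a)%g < len w)%N ->
  exists u k, [/\ (0 < k)%N, w = (u * altw a b k)%g, (len u + k <= len w)%N,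
    (len u <= len (u * gen a)%g)%N & (len u <= len (u * gen b)%g)%N].
Proof.
elim: n w a b => [|n IHn] w a b Da Db wn wa; first by rewrite leqn0 in wn; rewrite (eqP wn) in wa.
have [wb|wb] := ltnP (len (w * gen a * gen b)%g) (len (w * gen a)%g).
  have [|u [k [k0 wu lu ua ub]]] := IHn _ _ _ Db Da _ wb; first by lia.
  exists u, k.+1; split => //; last by lia.
  by rewrite /= mulgA -wu genK.
exists (w * gen a)%g, 1%N; split => //; last by rewrite genK// ltnW.
  by rewrite /= mul1g genK.
by rewrite addn1.
Qed.

(** Induction on the length of w. A descent b of w differs from a; removing the maximal alternating
    tail in r_a, r_b gives a shorter v that increases with both letters, so v a and v b are in the
    cone by induction. The tail sends a to a combination of a and b with Chebyshev coefficients, and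
    only their nonnegativity remains. *)
Lemma PLC_act_simple w a :
  Delta a -> (len w <= len (w * gen a)%g)%N -> PLC Delta (act w a).
Proof.
have [n] := ubnP (len w); elim: n w a => // n IHn w a wn Da wa.
have [->|/eqP w1] := eqVneq w 1%g; first by rewrite act1; exact: sub_PLC.
have [b Db wb] := len_descent w1.
have ab : b <> a by move=> e; move: wb; rewrite e ltnNge wa.
have [v [k [k0 wv lv vb va]]] := strip_altw Db Da (leqnn _) wb.
have vaP : PLC Delta (act v a) by apply: IHn => //; lia.
have vbP : PLC Delta (act v b) by apply: IHn => //; lia.
have [ck1 ck] : 0 <= chebyshev (- B b a) k.+1 /\ 0 <= chebyshev (- B b a) k.
  case: (hDelta) => _ /(_ b a Db Da ab)[[m [m2 mE]]|h] _; last first.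
    by split; apply: chebyshev_ge0; rewrite lerNr.
  (* For k < m both indices k and k + 1 are at most m, the range where the values are
     nonnegative. *)
  rewrite mE opprK; have [km|mk] := ltnP k m; first by split; apply: chebyshev_cos_ge0 => //; lia.
  (* Exchanging the two alternating words of length m would let a cancel. *)
  have ord : ((gen b * gen a) ^+ m)%g = 1%g.
    by case: hW => _ /(_ b a m Db Da ab (conj m2 mE))[].
  have [m' mm'] : exists m', m = m'.+1 by exists m.-1; lia.
  have [X lX altE] : exists2 X, (len (v * X)%g <= len v + (k - m))%N &
      altw b a k = (X * (altw b a m' * gen a))%g.
    exists (if odd m then altw a b (k - m) else altw b a (k - m)).
      by case: (odd m); apply: len_altw.
    rewrite -{1}(subnK mk) altw_add; congr (_ * _)%g.
    by rewrite (altw_swap Db Da ord) mm'.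
  suff : (len (w * gen a)%g < len w)%N by rewrite ltnNge wa.
  have -> : (w * gen a)%g = (v * X * altw b a m')%g.
    by rewrite wv altE !mulgA genK.
  have := len_altw (v * X)%g m' Db Da; lia.
have wa0 : act w a <> 0.
  move=> wa0; have := Phi_norm (Phi_act w (Phi_simple Da)).
  by rewrite wa0 -(scale0r 0) BZl mul0r => /esym/eqP; rewrite oner_eq0.
suff [] : act w a = 0 \/ PLC Delta (act w a) by [].
rewrite wv actM act_altw// act_comb.
by case: (odd k); apply: PLC_comb.
Qed.

Lemma PLC_act_simpleN w a :
  Delta a -> (len (w * gen a)%g < len w)%N -> PLC Delta (- act w a).
Proof.
move=> Da wa; rewrite -actN -act_gen_self// -actM; apply: PLC_act_simple => //.
by rewrite genK// ltnW.
Qed.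

Lemma Phi_sign x : Phi x -> Phi_pos x \/ Phi_neg x.
Proof.
move=> /[dup] xP [w [a [Da xE]]].
have [wa|wa] := leqP (len w) (len (w * gen a)%g).
  by left; split => //; rewrite xE; exact: PLC_act_simple.
by right; apply/Phi_negP; split => //; rewrite xE; exact: PLC_act_simpleN.
Qed.

Lemma Phi_pos_Phi x : Phi_pos x -> Phi x. Proof. by case. Qed.
Lemma Phi_pos_PLC x : Phi_pos x -> PLC Delta x. Proof. by case. Qed.

Lemma Phi_not_neg x : Phi x -> ~ Phi_neg x -> Phi_pos x.
Proof. by move=> /Phi_sign[]. Qed.

Lemma act_faithful w : (forall v, act w v = v) -> w = 1%g.
Proof.
move=> wv; have [//|/eqP w1] := eqVneq w 1%g.
have [a Da wa] := len_descent w1.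
have := PLC_act_simpleN Da wa; rewrite wv => /PLC_opp; rewrite opprK.
by case; exact: sub_PLC.
Qed.

Lemma act_ext w w' : (forall v, act w v = act w' v) -> w = w'.
Proof.
move=> ww'; apply: divg1_eq; apply: act_faithful => v.
by rewrite actM ww' actVK.
Qed.

(* Delta may be linearly dependent, so coefficients cannot be compared; instead
   one uses 0 \notin PLC(Delta) and (a, b) <= 0 for distinct simple roots. *)
Lemma simple_extremal a x p (k : R) : Delta a -> PLC Delta x -> PLC Delta p ->
  x + p = k *: a -> exists2 l, 0 < l & x = l *: a.
Proof.
move=> Da xP pP xpE.
pose E : set V := Delta `\ a.
have split_a : PLC Delta `<=` [set y |
    exists (l : R) y', [/\ 0 <= l, y' = 0 \/ PLC E y' & y = l *: a + y']].
  apply: PLC_min => [b Db|y z [l [y' [l0 hy ->]]] [m [z' [m0 hz ->]]]|c y c0 [l [y' [l0 hy ->]]]].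
  - have [->|/eqP ba] := eqVneq b a.
      by exists 1, 0; split; [exact: ler01|left|rewrite scale1r addr0].
    exists 0, b; split => //; last by rewrite scale0r add0r.
    by right; apply: sub_PLC.
  - exists (l + m), (y' + z'); split; [exact: addr_ge0| |by rewrite addrACA scalerDl].
    case: hy hz => [->|hy] [->|hz]; rewrite ?add0r ?addr0; [by left|by right..|].
    by right; exact: PLCD.
  - exists (c * l), (c *: y'); split; [by rewrite mulr_ge0// ltW| |by rewrite scalerDr scalerA].
    by case: hy => [->|hy]; [left; rewrite scaler0|right; exact: PLCZ].
have EP y : PLC E y -> PLC Delta y by apply: PLC_sub => b [].
have [l [x' [l0 [->|hx] xE]]] := split_a x xP.
  move: xE; rewrite addr0 => xE; exists l => //; rewrite lt_neqAle l0 andbT.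
  by apply/eqP => l00; apply: PLC_neq0; move: xP; rewrite xE -l00 scale0r.
have [m [p' [m0 hp pE]]] := split_a p pP.
have qP : PLC E (x' + p') by case: hp => [->|hp]; [rewrite addr0|exact: PLCD].
have qE : x' + p' = (k - l - m) *: a.
  move: xpE; rewrite xE pE addrACA -scalerDl => /(canRL (addKr _)) ->.
  by rewrite -scaleNr -scalerDl; congr (_ *: _); ring.
(* The part of x + p outside a equals (k - l - m) a. A nonpositive coefficient would put 0 in the
   cone; a positive one contradicts (b, a) <= 0 for the other simple roots b. *)
have [c0|c0] := leP (k - l - m) 0; exfalso.
  apply: PLC_neq0; have := EP _ qP; rewrite qE.
  move: c0; rewrite le_eqVlt => /predU1P[->|c0]; first by rewrite scale0r.
  move=> hq; have := PLCD hq (PLCZ (_ : 0 < - (k - l - m)) (sub_PLC Da)).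
  by rewrite -scalerDl subrr scale0r; apply; rewrite oppr_gt0.
have : B (x' + p') a <= 0.
  apply: (PLC_min (P := [set y | B y a <= 0])) qP => [b [Db /= ba]|y z /= hy hz|c y /= c1 hy].
  - exact: simple_B_le0.
  - by rewrite BDl; lra.
  - by rewrite BZl pmulr_rle0.
by rewrite qE BZl simple_norm// mulr1 leNgt c0.
Qed.

(** * Reflections *)

Lemma pos_proportional x y (k : R) : Phi_pos x -> Phi_pos y -> x = k *: y -> x = y.
Proof.
move=> xP yP xE; have := Phi_norm (Phi_pos_Phi xP).
rewrite xE BZl BZr (Phi_norm (Phi_pos_Phi yP)) mulr1 -expr2 => /eqP.
rewrite sqrf_eq1 => /orP[]/eqP kE; first by rewrite kE scale1r.
by move: xP; rewrite xE kE scaleN1r => /Phi_pos_neg []; exact: Phi_posN.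
Qed.

(** If r_a x were negative, x and - r_a x would be in the cone with sum 2 (x, a) a, so x would be
    proportional to a. *)
Lemma simple_perm a x : Delta a -> Phi_pos x -> x <> a -> Phi_pos (act (gen a) x).
Proof.
move=> Da xP xa; apply: Phi_not_neg => [|/Phi_negP[_ pP]]; first exact/Phi_act/Phi_pos_Phi.
have [|l _ xE] := simple_extremal (k := 2 * B x a) Da (Phi_pos_PLC xP) pP.
  by rewrite act_gen// opprB addrC subrK.
by apply: xa; exact: pos_proportional xP (simple_pos Da) xE.
Qed.

(** By [simple_perm], each simple reflection multiplied on the left contributes at most one new
    inversion, the preimage of its simple root. *)
Lemma inversions_finite w : finite_set [set y | Phi_pos y /\ Phi_neg (act w y)].
Proof.
elim/W_ind: w => [|a w Da IHw].
  rewrite (_ : [set y | _] = set0)// -subset0 => y [yP].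
  by rewrite act1 => /(Phi_pos_neg yP).
apply: (@sub_finite_set _ _ ([set act w^-1%g a] `|` [set y | Phi_pos y /\ Phi_neg (act w y)])).
  move=> y [yP]; rewrite actM => ny.
  have [wy|wy] := Phi_sign (Phi_act w (Phi_pos_Phi yP)); last by right.
  left => /=; apply: (@act_inj w); rewrite actVK; apply: contrapT => wya.
  by case: (Phi_pos_neg (simple_perm Da wy wya)).
by rewrite finite_setU; split.
Qed.

Lemma refl_exists x : Phi x ->
  exists t, T t /\ forall v, act t v = v - (2 * B v x) *: x.
Proof.
move=> [w [a [Da ->]]]; exists (w * gen a * w^-1)%g; split.
  by exists w, (gen a); split => //; exists a.
move=> v; rewrite !actM act_gen// actD actVK actN actZ.
by rewrite -[B (act _ v) _](actB w) actVK.
Qed.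

Lemma reflP x : Phi x -> T (refl x) /\ forall v, act (refl x) v = v - (2 * B v x) *: x.
Proof. by move=> /refl_exists h; rewrite /Defs.refl; apply: (xgetPex _ h). Qed.

Lemma refl_T x : Phi x -> T (refl x). Proof. by case/reflP. Qed.

Lemma act_refl x v : Phi x -> act (refl x) v = v - (2 * B v x) *: x.
Proof. by case/reflP. Qed.

Lemma refl_eq x t : Phi x ->
  (forall v, act t v = v - (2 * B v x) *: x) -> refl x = t.
Proof. by move=> xP tE; apply: act_ext => v; rewrite act_refl. Qed.

Lemma refl_act w x : Phi x -> refl (act w x) = (w * refl x * w^-1)%g.
Proof.
move=> xP; apply: refl_eq => [|v]; first exact: Phi_act.
rewrite !actM act_refl// actD actVK actN actZ.
by rewrite -[B (act _ v) _](actB w) actVK.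
Qed.

Lemma reflN x : Phi x -> refl (- x) = refl x.
Proof.
move=> xP; apply: refl_eq => [|v]; first exact: PhiN.
by rewrite act_refl// BNr mulrN scaleNr scalerN opprK.
Qed.

Lemma act_refl_self x : Phi x -> act (refl x) x = - x.
Proof.
by move=> xP; rewrite act_refl// Phi_norm// mulr1 scaler_nat mulr2n opprD addrA subrr add0r.
Qed.

Lemma refl_sq x : Phi x -> (refl x * refl x)%g = 1%g.
Proof.
move=> xP; apply: act_faithful => v; rewrite actM (act_refl v)// actD actN actZ.
by rewrite act_refl_self// scalerN opprK act_refl// subrK.
Qed.

Lemma act_reflK x v : Phi x -> act (refl x) (act (refl x) v) = v.
Proof. by move=> xP; rewrite -actM refl_sq// act1. Qed.

Lemma refl_inj x y : Phi_pos x -> Phi_pos y -> refl x = refl y -> x = y.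
Proof.
move=> xP yP xy; have /eqP := act_refl_self (Phi_pos_Phi xP).
rewrite xy (act_refl _ (Phi_pos_Phi yP)) subr_eq addrC -subr_eq opprK -mulr2n => /eqP xE.
apply: (pos_proportional (k := B x y) xP yP); apply: (@scalerI _ _ 2); first by rewrite pnatr_eq0.
by rewrite scaler_nat xE scalerA.
Qed.

Lemma refl_simple a : Delta a -> refl a = gen a.
Proof. by move=> Da; apply: refl_eq => [|v]; [exact: Phi_simple|exact: act_gen]. Qed.

Lemma T_refl t : T t -> exists x, Phi_pos x /\ refl x = t.
Proof.
move=> [w [_ [[a Da <-] ->]]]; have xP : Phi (act w a) by exact/Phi_act/Phi_simple.
have rE : refl (act w a) = (w * gen a * w^-1)%g.
  by rewrite refl_act ?refl_simple//; exact: Phi_simple.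
have [h|h] := Phi_sign xP; first by exists (act w a).
by exists (- act w a); rewrite reflN.
Qed.

Local Notation alpha := (alpha B Delta gen act).

Lemma alphaP t : T t -> Phi_pos (alpha t) /\ refl (alpha t) = t.
Proof. by move=> /T_refl h; rewrite /Defs.alpha; apply: (xgetPex _ h). Qed.

Lemma alpha_refl x : Phi_pos x -> alpha (refl x) = x.
Proof.
by move=> xP; have [? ?] := alphaP (refl_T (Phi_pos_Phi xP)); exact: refl_inj.
Qed.

(** * Canonical generators of reflection subgroups *)

(** Canonical roots described by signs instead of lengths; [canonical_rootsP] shows that the two
    descriptions agree. *)
Definition simple_root H c :=
  [/\ Phi_pos c, H (refl c) & forall y, Phi_pos y -> H (refl y) -> y <> c ->
      Phi_pos (act (refl c) y)].

Definition refl_word (s : seq V) : W := (\prod_(c <- s) refl c)%g.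

Lemma refl_word_cons c s : refl_word (c :: s) = (refl c * refl_word s)%g.
Proof. exact: big_cons. Qed.

Lemma refl_word_cat s1 s2 : refl_word (s1 ++ s2) = (refl_word s1 * refl_word s2)%g.
Proof. exact: big_cat. Qed.

Lemma simple_root_Phi H c : simple_root H c -> Phi c.
Proof. by case=> -[]. Qed.

Lemma simple_root_pos H c : simple_root H c -> Phi_pos c.
Proof. by case. Qed.

Lemma simple_root_mem H c : simple_root H c -> H (refl c).
Proof. by case. Qed.

Lemma refl_word_mem H s : is_subgroup H ->
  (forall c, c \in s -> simple_root H c) -> H (refl_word s).
Proof.
by move=> HH sH; apply: subgroup_prod => // c /sH /simple_root_mem.
Qed.

Lemma refl_mem_act H w x : is_subgroup H -> H w -> Phi x -> H (refl x) ->
  H (refl (act w x)).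
Proof.
by move=> HH Hw xP Hx; rewrite refl_act//; apply: subgroupM => //; [exact: subgroupM|exact: subgroupV].
Qed.

(** The strong exchange condition relative to H. Applying the letters from the right, y turns
    negative at some letter c; just before, its image is a positive root of H made negative by r_c,
    hence c itself. So r_c is the conjugate of r_y by the letters on the right, and multiplying by
    r_y cancels that letter. *)
Lemma exchange H (s : seq V) y : is_subgroup H ->
  (forall c, c \in s -> simple_root H c) -> Phi_pos y -> H (refl y) ->
  Phi_neg (act (refl_word s) y) ->
  exists s1 c s2, s = s1 ++ c :: s2 /\
    (refl_word s * refl y)%g = refl_word (s1 ++ s2).
Proof.
move=> HH; elim: s => [|c s IHs] sH yP Hy.
  by rewrite /refl_word big_nil act1 => /(Phi_pos_neg yP).
have sH' d : d \in s -> simple_root H d by move=> ds; apply: sH; rewrite inE ds orbT.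
have cH := sH c (mem_head _ _).
rewrite refl_word_cons actM => neg.
have [zP|zN] := Phi_sign (Phi_act (refl_word s) (Phi_pos_Phi yP)); last first.
  have [s1 [d [s2 [-> e]]]] := IHs sH' yP Hy zN.
  by exists (c :: s1), d, s2; rewrite -mulgA e cat_cons refl_word_cons.
exists [::], c, s; split => //=.
have zc : act (refl_word s) y = c.
  apply: contrapT => zc; case: cH => _ _ /(_ _ zP _ zc) h; apply: Phi_pos_neg neg.
  by apply: h; apply: refl_mem_act => //; [exact: refl_word_mem|exact: Phi_pos_Phi].
have := refl_act (refl_word s) (Phi_pos_Phi yP); rewrite zc => e.
by rewrite e mulgVK -mulgA refl_sq ?mulg1//; exact: Phi_pos_Phi.
Qed.

Lemma subgroup_setT : is_subgroup (@setT W).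
Proof. by apply: subgroupI. Qed.

Lemma simple_root_simple H a : Delta a -> H (gen a) -> simple_root H a.
Proof.
move=> Da Ha; split; [exact: simple_pos|by rewrite refl_simple|].
by move=> y yP _ ya; rewrite refl_simple//; exact: simple_perm.
Qed.

Lemma refl_word_simple s : (forall a, a \in s -> Delta a) ->
  refl_word s = (\prod_(x <- map gen s) x)%g.
Proof.
move=> sD; rewrite big_map /refl_word big_seq [RHS]big_seq.
by apply: eq_bigr => a /sD Da; rewrite refl_simple.
Qed.

Lemma len_reduced w : exists s, [/\ forall a, a \in s -> Delta a, w = refl_word s &
  size s = len w].
Proof.
have [[s [sS wE] sw] _] := word_lengthP S_inv (S_gen w).
have [s' [sD sE]] := image_seq sS; exists s'; split => //.
  by rewrite refl_word_simple// -sE.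
by rewrite /Defs.len -sw sE size_map.
Qed.

Lemma len_word s : (forall a, a \in s -> Delta a) -> (len (refl_word s) <= size s)%N.
Proof.
move=> sD; have [_ /(_ (map gen s))] := word_lengthP S_inv (S_gen (refl_word s)).
rewrite size_map; apply; split; last exact: refl_word_simple.
by move=> _ /mapP[a /sD Da ->]; exists a.
Qed.

Lemma len_refl_neg w x : Phi_pos x -> Phi_neg (act w x) ->
  (len (w * refl x)%g < len w)%N.
Proof.
move=> xP; have [s [sD -> sw]] := len_reduced w => neg.
have [||s1 [c [s2 [sE ->]]]] := exchange subgroup_setT _ xP _ neg => //.
  by move=> c /sD Dc; exact: simple_root_simple.
rewrite -sw sE; apply: leq_ltn_trans (len_word _) _; last by rewrite !size_cat /= addnS ltnS.
by move=> a; rewrite mem_cat => h; apply: sD; rewrite sE mem_cat inE orbCA h orbT.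
Qed.

Lemma len_refl_pos w x : Phi_pos x -> Phi_pos (act w x) ->
  (len w < len (w * refl x)%g)%N.
Proof.
move=> xP wx; have xPhi := Phi_pos_Phi xP.
have := @len_refl_neg (w * refl x)%g x xP; rewrite -mulgA refl_sq// mulg1; apply.
by rewrite actM act_refl_self// actN; exact: Phi_posN.
Qed.

(** By [len_refl_neg] and [len_refl_pos], multiplying t by r_y on the right shortens it exactly when
    t y is negative. The condition on [Nbar] thus says that t makes no positive root of H negative
    except its own. *)
Lemma canonical_generatorsP H t :
  canonical_generators Delta gen H t <-> exists c, simple_root H c /\ refl c = t.
Proof.
split=> [[Tt NH]|[c [[cP Hc cH] <-]]].
  have [cP ct] := alphaP Tt; exists (alpha t); split => //.
  have [_ Ht] : (Nbar Delta gen t `&` H) t by rewrite NH.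
  split=> [//||y yP Hy yc]; first by rewrite ct.
  have yPhi := Phi_pos_Phi yP.
  apply: Phi_not_neg; first exact: Phi_act.
  rewrite ct => /(len_refl_neg yP) h; apply: yc; apply: refl_inj => //.
  rewrite ct; have : (Nbar Delta gen t `&` H) (refl y).
    by split => //; split => //; exact: refl_T.
  by rewrite NH.
have cPhi := Phi_pos_Phi cP.
split; first exact: refl_T.
apply/seteqP; split => [u [[Tu lu] Hu]|_ ->] /=.
  have [yP yu] := alphaP Tu; move: lu Hu; rewrite -yu => lu Hu.
  have [->//|/eqP yc] := eqVneq (alpha u) c.
  by move: lu; rewrite ltnNge ltnW//; apply: len_refl_pos => //; exact: cH.
split=> //; split; [exact: refl_T|apply: len_refl_neg => //].
by rewrite act_refl_self//; exact: Phi_posN.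
Qed.

Lemma canonical_rootsP H x :
  canonical_roots B Delta gen act H x <-> simple_root H x.
Proof.
split=> [[xP /canonical_generatorsP[c [cH cx]]]|xH].
  by rewrite -(refl_inj (simple_root_pos cH) xP cx).
by split; [exact: simple_root_pos xH|apply/canonical_generatorsP; exists x].
Qed.

Definition generated_by_simple H w :=
  exists s, (forall c, c \in s -> simple_root H c) /\ w = refl_word s.

Lemma generated_by_simpleM H w w' : generated_by_simple H w ->
  generated_by_simple H w' -> generated_by_simple H (w * w')%g.
Proof.
move=> [s [sH ->]] [s' [sH' ->]]; exists (s ++ s'); rewrite refl_word_cat; split=> //.
by move=> c; rewrite mem_cat => /orP[/sH|/sH'].
Qed.

Lemma generated_by_simple_refl H c : simple_root H c -> generated_by_simple H (refl c).
Proof.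
move=> cH; exists [:: c]; split; last by rewrite /refl_word big_seq1.
by move=> d; rewrite inE => /eqP->.
Qed.

Lemma refl_word_act w s : (forall c, c \in s -> Phi c) ->
  refl_word (map (act w) s) = (w * refl_word s * w^-1)%g.
Proof.
elim: s => [|c s IHs] sP; first by rewrite /refl_word !big_nil mulg1 mulgV.
rewrite /= !refl_word_cons IHs => [|d ds]; last by apply: sP; rewrite inE ds orbT.
rewrite refl_act; last by apply: sP; exact: mem_head.
by rewrite !mulgA mulgVK.
Qed.

(* Dyer's argument: conjugating by a simple reflection r outside H turns the
   canonical generators of H into those of r H r. *)
Lemma refl_generated_by_simple H x : is_subgroup H -> Phi_pos x -> H (refl x) ->
  generated_by_simple H (refl x).
Proof.
move=> HH xP; case: (xP) => -[w [a [Da xE]]] _; rewrite {x}xE in xP *.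
(* H varies in the induction, since removing the letter r_b replaces it by its conjugate. *)
elim/W_ind: w H a HH Da xP => [|b w Db IHw] H a HH Da.
  rewrite act1 refl_simple// => _ Ha; rewrite -refl_simple//.
  exact/generated_by_simple_refl/simple_root_simple.
rewrite actM; set x' := act w a => xP Hx.
have x'P : Phi x' by exact/Phi_act/Phi_simple.
have [xb|/eqP xb] := eqVneq (act (gen b) x') b.
  rewrite xb; apply: generated_by_simple_refl; apply: simple_root_simple => //.
  by rewrite -refl_simple// -xb.
have gV : (gen b)^-1%g = gen b by apply: mulg1_eq; exact: gen_sq.
have actbK v : act (gen b) (act (gen b) v) = v by rewrite -actM gen_sq// act1.
have x'pos : Phi_pos x' by rewrite -[x']actbK; exact: simple_perm.
pose H' : set W := [set g | H (gen b * g * gen b)%g].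
have HH' : is_subgroup H'.
  apply: subgroupI => [|g h Hg Hh|g Hg]; rewrite /H' /=.
  - by rewrite mulg1 gen_sq//; exact: subgroup1.
  - have := subgroupM HH Hg Hh.
    by rewrite !mulgA genK.
  - by have := subgroupV HH Hg; rewrite !invgM gV mulgA.
have H'refl y : Phi y -> H' (refl y) <-> H (refl (act (gen b) y)).
  by move=> yP; rewrite refl_act// gV.
have [s [sH' x'E]] := IHw H' a HH' Da x'pos ((H'refl _ x'P).2 Hx).
(* If r_b is in H, conjugation by it fixes H, and r_b is itself a canonical generator. Otherwise b
   is not a root of H or H', so r_b preserves the positivity of all their positive roots. *)
have [Hb|Hb] := pselect (H (gen b)).
  have H'H : H' = H.
    apply/seteqP; split => g; rewrite /H' /= => Hg.
      have : H (gen b * (gen b * g * gen b) * gen b)%g by do 2?apply: subgroupM => //.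
      by rewrite !mulgA genK// gen_sq// mul1g.
    by do 2?apply: subgroupM => //.
  have bH := generated_by_simple_refl (simple_root_simple Db Hb).
  rewrite refl_act// gV -refl_simple//; apply: generated_by_simpleM => //.
  by apply: generated_by_simpleM => //; exists s; rewrite -H'H.
exists (map (act (gen b)) s); split; last first.
  by rewrite refl_word_act -?x'E => [|c /sH'/simple_root_Phi//]; exact: refl_act.
move=> _ /mapP[c /sH' cH' ->].
have [cP Hc cperm] := cH'; have cPhi := Phi_pos_Phi cP.
have not_b y : Phi_pos y -> H' (refl y) -> y <> b.
  move=> yP Hy yb; apply: Hb; move: Hy; rewrite /H' /= yb refl_simple//.
  by rewrite gen_sq// mul1g.
split; [by apply: simple_perm => //; exact: not_b|exact/H'refl|].
move=> y yP Hy yc; have yPhi := Phi_pos_Phi yP.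
have yb : y <> b by move=> e; apply: Hb; rewrite -refl_simple// -e.
have y'P := simple_perm Db yP yb; have y'Phi := Phi_pos_Phi y'P.
have Hy' : H' (refl (act (gen b) y)) by apply/H'refl => //; rewrite actbK.
rewrite refl_act// gV !actM; apply: simple_perm => //.
  by apply: cperm => // e; apply: yc; rewrite -e actbK.
apply: not_b; first by apply: cperm => // e; apply: yc; rewrite -e actbK.
exact: refl_mem_act.
Qed.

Lemma reflection_subgroup_generated H w : reflection_subgroup Delta gen H -> H w ->
  generated_by_simple H w.
Proof.
move=> [HH HE]; rewrite {1}HE => /generatedP[t [_ Tt]|s [sT ->]].
  by have [x [xP <-]] := T_refl Tt; rewrite refl_sq//; exact: Phi_pos_Phi.
elim: s sT => [|t s IHs] sT; first by exists [::]; rewrite /refl_word !big_nil.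
rewrite big_cons; apply: generated_by_simpleM; last first.
  by apply: IHs => u us; apply: sT; rewrite inE us orbT.
have [Ht Tt] := sT t (mem_head _ _); move: Ht; have [x [xP <-]] := T_refl Tt => Ht.
exact: refl_generated_by_simple.
Qed.

Lemma comb_npos x y (p q : R) : PLC Delta x -> PLC Delta y -> p <= 0 -> q <= 0 ->
  ~ PLC Delta (p *: x + q *: y).
Proof.
move=> xP yP p0 q0 cP.
have [|//|e|h] := PLC_comb (p := - p) (q := - q) _ _ xP yP; rewrite ?oppr_ge0//.
  by apply: PLC_neq0; rewrite -oppr0 -e combN !opprK.
by apply: (PLC_opp cP); rewrite combN.
Qed.

(* If (c, d) = k > 0 then c, d, r_c d, r_d c and r_c r_d c are all positive
   roots, but a nonnegative combination of them vanishes. *)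
Lemma simple_root_B_le0 H c d : is_subgroup H -> simple_root H c ->
  simple_root H d -> c <> d -> B c d <= 0.
Proof.
move=> HH cH dH cd; rewrite leNgt; apply/negP => k0.
have [cP Hc cperm] := cH; have [dP Hd dperm] := dH.
have cPhi := Phi_pos_Phi cP; have dPhi := Phi_pos_Phi dP.
have [cPLC dPLC] := (Phi_pos_PLC cP, Phi_pos_PLC dP).
set k := B c d in k0.
have rcdP : Phi_pos (act (refl c) d) by apply: cperm => // e; apply: cd.
have rdcP : Phi_pos (act (refl d) c) by exact: dperm.
have rcdE : act (refl c) d = (- (2 * k)) *: c + 1 *: d.
  by rewrite act_refl// BC scale1r scaleNr addrC.
have rdcE : act (refl d) c = 1 *: c + (- (2 * k)) *: d.
  by rewrite act_refl// scale1r scaleNr.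
(* If 4 k^2 > 1, then r_c d + 2 k r_d c = (1 - 4 k^2) d is not in the cone. If 4 k^2 <= 1, the root
   r_c r_d c = (4 k^2 - 1) c - 2 k d is not. *)
have [k1|k1] := leP (4 * k * k) 1; last first.
  have := PLCD (Phi_pos_PLC rcdP) (PLCZ (mulr_gt0 (ltr0n R 2) k0) (Phi_pos_PLC rdcP)).
  rewrite rcdE rdcE combZ combD; apply: comb_npos => //; first by rewrite mulr1 addNr.
  by lra.
have rrP : Phi_pos (act (refl c) (act (refl d) c)).
  apply: cperm => //; first exact: refl_mem_act.
  move=> e; have := actB (refl d) c d; rewrite e act_refl_self// BNr -/k; lra.
have := Phi_pos_PLC rrP; rewrite rdcE act_comb rcdE act_refl_self//.
rewrite [1 *: - c]scale1r -[- c]scaleN1r combZ addrA -scalerDl; apply: comb_npos => //; lra.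
Qed.

(** Each reflection moves a vector by a multiple of its root. Applied to a word equal to r_z, which
    moves z by -2 z, this puts z in the plane: see [plane_root]. *)
Lemma plane_refl_word a b s v : (forall c, c \in s -> Phi c /\ plane a b c) ->
  plane a b (act (refl_word s) v - v).
Proof.
elim: s => [|c s IHs] sP.
  by rewrite /refl_word big_nil act1 subrr; exact: plane0.
have [cP cab] := sP c (mem_head _ _).
rewrite refl_word_cons actM act_refl// addrAC -scaleNr; apply: planeD.
  by apply: IHs => d ds; apply: sP; rewrite inE ds orbT.
exact: planeZ.
Qed.

Lemma plane_root a b z : Phi z -> plane a b (act (refl z) z - z) -> plane a b z.
Proof.
move=> zP; rewrite act_refl_self// -opprD -mulr2n => /(planeZ (- 2^-1)).
by rewrite scalerN scaleNr opprK -[z *+ 2]scaler_nat scalerA mulVf ?scale1r// pnatr_eq0.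
Qed.

(** Cramer's rule. If the determinant vanished, a and b would be proportional, which distinct
    positive roots are not. *)
Lemma plane_basis a b x y : Phi_pos a -> Phi_pos b -> a <> b ->
  plane x y a -> plane x y b -> plane a b x /\ plane a b y.
Proof.
move=> aP bP ab [p [q aE]] [p' [q' bE]].
have ex : (p * q' - p' * q) *: x = q' *: a + (- q) *: b.
  rewrite aE bE !combZ combD.
  by rewrite [X in _ + X *: y](_ : _ = 0) ?scale0r ?addr0; [congr (_ *: _)|]; ring.
have ey : (p * q' - p' * q) *: y = (- p') *: a + p *: b.
  rewrite aE bE !combZ combD.
  by rewrite [X in X *: x + _](_ : _ = 0) ?scale0r ?add0r; [congr (_ *: _)|]; ring.
have [D0|D0] := eqVneq (p * q' - p' * q) 0; last first.
  split; [exists ((p * q' - p' * q)^-1 * q'), ((p * q' - p' * q)^-1 * - q)|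
    exists ((p * q' - p' * q)^-1 * - p'), ((p * q' - p' * q)^-1 * p)].
    by rewrite -combZ -ex scalerA mulVf// scale1r.
  by rewrite -combZ -ey scalerA mulVf// scale1r.
have noprop (k l : R) : k != 0 -> l *: a + k *: b = 0 -> False.
  move=> k0 /eqP; rewrite addrC addr_eq0 => /eqP e; apply: ab; apply/esym.
  apply: (@pos_proportional _ _ (k^-1 * - l) bP aP).
  by rewrite -scalerA scaleNr -e scalerA mulVf// scale1r.
exfalso; move: ex ey; rewrite D0 !scale0r => /esym ex /esym ey.
have [p0|p0] := eqVneq p 0; last exact: noprop ey.
have [q0|q0] := eqVneq q 0; last by apply: noprop ex; rewrite oppr_eq0.
by apply: PLC_neq0; move: (Phi_pos_PLC aP); rewrite aE p0 q0 !scale0r addr0.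
Qed.

(** Let c = p a + q b be a third canonical root; all products of two among a, b, c are <= 0. If p, q
    > 0, then (c, c) <= 0. If p > 0 >= q, then (c, a) = p + q (a, b) > 0, and symmetrically. If p, q
    <= 0, then c is not positive. *)
Lemma simple_root_plane H a b c : is_subgroup H -> simple_root H a ->
  simple_root H b -> simple_root H c -> a <> b -> plane a b c -> c = a \/ c = b.
Proof.
move=> HH aH bH cH ab [p [q cE]].
apply: contrapT => /not_orP[ca cb].
have Bac := simple_root_B_le0 HH cH aH ca.
have Bbc := simple_root_B_le0 HH cH bH cb.
have Bab := simple_root_B_le0 HH aH bH ab.
have norm z : simple_root H z -> B z z = 1 by move=> /simple_root_Phi/Phi_norm.
have cc : p * B c a + q * B c b = 1 by rewrite -BZr -BZr -BDr -cE norm.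
have ca' : B c a = p + q * B a b by rewrite cE BDl !BZl norm// mulr1 [B b a]BC.
have cb' : B c b = p * B a b + q by rewrite cE BDl !BZl (norm b)// mulr1.
have [p0|p0] := leP p 0; have [q0|q0] := leP q 0; last first.
- by clear cE ca cb ab; nra.
- by clear cE ca cb ab; nra.
- by clear cE ca cb ab; nra.
- move: (Phi_pos_PLC (simple_root_pos cH)); rewrite cE.
  by apply: comb_npos => //; apply/Phi_pos_PLC; [exact: simple_root_pos aH|exact: simple_root_pos bH].
Qed.

(** * Dihedral reflection subgroups *)

Definition dihedral_roots H a b :=
  [/\ is_subgroup H, simple_root H a /\ simple_root H b, a <> b,
      forall c, simple_root H c -> c = a \/ c = b &
      forall w, H w -> generated_by_simple H w].

Lemma dihedral_rootsC H a b : dihedral_roots H a b -> dihedral_roots H b a.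
Proof.
move=> [HH [aH bH] ab Hab Hw]; split=> //; first by move=> e; exact: ab.
by move=> c /Hab[]; [right|left].
Qed.

Lemma dihedral_reflection_subgroupP H : dihedral_reflection_subgroup Delta gen H ->
  exists a b, dihedral_roots H a b.
Proof.
move=> [HR /card_eq2P[s [t [st Hst]]]].
have /canonical_generatorsP[a [aH sE]] : canonical_generators Delta gen H s by rewrite Hst; left.
have /canonical_generatorsP[b [bH tE]] : canonical_generators Delta gen H t by rewrite Hst; right.
exists a, b; split=> //; first by case: HR.
- by move=> ab; apply: st; rewrite -sE -tE ab.
- move=> c cH; have : canonical_generators Delta gen H (refl c).
    by apply/canonical_generatorsP; exists c.
  have [aP bP cP] := And3 (simple_root_pos aH) (simple_root_pos bH) (simple_root_pos cH).
  by rewrite Hst -sE -tE => -[/= /refl_inj->|/= /refl_inj->]//; [left|right].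
- by move=> w; exact: reflection_subgroup_generated.
Qed.

Lemma dihedral_roots_dihedral H a b : reflection_subgroup Delta gen H ->
  dihedral_roots H a b -> dihedral_reflection_subgroup Delta gen H.
Proof.
move=> HR [HH [aH bH] ab Hab _]; split=> //; apply/card_eq2P.
exists (refl a), (refl b); split.
  by move=> e; apply: ab; apply: refl_inj e; [exact: simple_root_pos aH|exact: simple_root_pos bH].
apply/seteqP; split=> [t /canonical_generatorsP[c [/Hab[]-> <-]]|_ []->] /=.
- by left.
- by right.
- by apply/canonical_generatorsP; exists a.
- by apply/canonical_generatorsP; exists b.
Qed.

Lemma dihedral_plane H a b z : dihedral_roots H a b -> Phi z -> H (refl z) ->
  plane a b z.
Proof.
move=> [_ _ _ Hab Hw] zP /Hw[s [sH zE]]; apply: plane_root => //.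
rewrite zE; apply: plane_refl_word => c /sH cH; split; first exact: simple_root_Phi cH.
by case: (Hab c cH) => ->; [exact: plane_l|exact: plane_r].
Qed.

(** Suppose z = p a + q b with p > 0 > q. Then r_a z = (- p - 2 q (a, b)) a + q b has nonpositive
    coefficients because (a, b) <= 0, although r_a keeps z positive. *)
Lemma dihedral_cone H a b z : dihedral_roots H a b -> Phi_pos z -> H (refl z) ->
  exists p q : R, [/\ 0 <= p, 0 <= q & z = p *: a + q *: b].
Proof.
move=> Hab zP Hz; have [p [q zE]] := dihedral_plane Hab (Phi_pos_Phi zP) Hz.
have [->|/eqP za] := eqVneq z a.
  by exists 1, 0; split; rewrite ?ler01// scale0r addr0 scale1r.
have [->|/eqP zb] := eqVneq z b.
  by exists 0, 1; split; rewrite ?ler01// scale0r add0r scale1r.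
have key a' b' (p' q' : R) : dihedral_roots H a' b' -> z <> a' ->
    z = p' *: a' + q' *: b' -> 0 < p' -> q' < 0 -> False.
  move=> [HH [aH bH] ab _ _] za' zE' p0 q0.
  have [aP _ aperm] := aH; have aPhi := Phi_pos_Phi aP.
  have Bab := simple_root_B_le0 HH bH aH (fun e => ab (esym e)).
  have := Phi_pos_PLC (aperm z zP Hz za').
  have -> : act (refl a') z = (- p' - q' * (2 * B b' a')) *: a' + q' *: b'.
    rewrite zE' act_comb act_refl_self// (act_refl b')//.
    by rewrite scalerN scalerBr scalerA addrA addrAC scalerBl scaleNr.
  apply: comb_npos (Phi_pos_PLC aP) (Phi_pos_PLC (simple_root_pos bH)) _ (ltW q0).
  by nra.
have [aP bP] : PLC Delta a /\ PLC Delta b.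
  by case: Hab => _ [/simple_root_pos/Phi_pos_PLC ? /simple_root_pos/Phi_pos_PLC ?].
have [p0|p0] := ltP p 0; have [q0|q0] := ltP q 0; last by exists p, q.
- by move: (Phi_pos_PLC zP); rewrite zE => /(comb_npos aP bP (ltW p0) (ltW q0)).
- move: q0; rewrite le_eqVlt => /predU1P[q0|q0].
    by exfalso; move: (Phi_pos_PLC zP); rewrite zE; apply: comb_npos => //; rewrite ?(ltW p0)// -q0.
  by case: (key b a q p (dihedral_rootsC Hab) zb) => //; rewrite addrC.
- move: p0; rewrite le_eqVlt => /predU1P[p0|p0].
    by exfalso; move: (Phi_pos_PLC zP); rewrite zE; apply: comb_npos => //; rewrite ?(ltW q0)// -p0.
  by case: (key a b p q Hab za zE).
Qed.

(** Write a nonempty word for w as w' r_c. Since w c is positive, w' c is negative, and exchange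
    rewrites w' r_c with two letters fewer. *)
Lemma dihedral_trivial H a b w : dihedral_roots H a b -> H w ->
  Phi_pos (act w a) -> Phi_pos (act w b) -> w = 1%g.
Proof.
move=> [HH [aH bH] ab Hab Hw] /Hw[s [sH ->]].
have [n] := ubnP (size s); elim: n s sH => // n IHn s sH sn.
case/lastP: s => [|s c] in sH sn * => waP wbP; first by rewrite /refl_word big_nil.
have cH : simple_root H c by apply: sH; rewrite mem_rcons mem_head.
have sH' d : d \in s -> simple_root H d by move=> ds; apply: sH; rewrite mem_rcons inE ds orbT.
have wcP : Phi_pos (act (refl_word (rcons s c)) c) by case: (Hab c cH) => {2}->.
have wE : refl_word (rcons s c) = (refl_word s * refl c)%g.
  by rewrite -cats1 refl_word_cat /refl_word big_seq1.
have neg : Phi_neg (act (refl_word s) c).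
  rewrite /Defs.Phi_neg /= -actN -act_refl_self; last exact: simple_root_Phi cH.
  by rewrite -actM -wE.
have [s1 [d [s2 [sE e]]]] := exchange HH sH' (simple_root_pos cH) (simple_root_mem cH) neg.
move: waP wbP; rewrite wE e; apply: IHn.
  by move=> d' h; apply: sH'; rewrite sE mem_cat inE orbCA -mem_cat h orbT.
by move: sn; rewrite sE size_rcons !size_cat /=; lia.
Qed.

(** An element of H is determined by the positive roots of H that it inverts: if w and w' invert the
    same ones, w' w^-1 keeps a and b positive and is trivial. Finitely many roots would leave
    finitely many inversion sets. *)
Lemma dihedral_infinite_roots H a b : dihedral_roots H a b -> infinite_set H ->
  infinite_set [set y | Phi_pos y /\ H (refl y)].
Proof.
move=> Hab Hinf; set F : set V := [set y | _] => Ffin; apply: Hinf.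
pose inv w := [set y | F y /\ Phi_neg (act w y)].
have [HH [aH bH] _ _ _] := Hab.
have inv_inj w w' : H w -> H w' -> inv w = inv w' -> w = w'.
  move=> Hw Hw' e.
  have main z : simple_root H z -> Phi_pos (act (w' * w^-1)%g z).
    move=> [zP Hz _]; rewrite actM; set y := act w^-1%g z.
    have yPhi : Phi y by exact/Phi_act/Phi_pos_Phi.
    have Hy : H (refl y).
      by apply: refl_mem_act => //; [exact: subgroupV|exact: Phi_pos_Phi].
    have wy : act w y = z by rewrite /y actVK.
    have [yP|yN] := Phi_sign yPhi.
      apply: Phi_not_neg; first exact: Phi_act.
      move=> neg; have : inv w' y by [].
      by rewrite -e => -[_]; rewrite wy; exact: Phi_pos_neg.
    have : inv w (- y).
      split; first by split; rewrite ?reflN.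
      by rewrite actN wy; exact: Phi_posN.
    by rewrite e => -[_]; rewrite actN /Defs.Phi_neg /= opprK.
  have H1 : H (w' * w^-1)%g by apply: subgroupM => //; exact: subgroupV.
  exact/esym/divg1_eq/(dihedral_trivial Hab H1 (main a aH) (main b bH)).
have inv_fin w : finite_set (inv w) by apply: sub_finite_set Ffin => y [].
pose g w := fset_set (inv w).
have ginj : {in H &, injective g}.
  move=> w w'; rewrite !inE => Hw Hw' /fset_set_inj e.
  by apply: inv_inj => //; exact: e.
rewrite -(eq_finite_set (inj_card_eq ginj)).
apply: sub_finite_set (finite_fset (fpowerset (fset_set F))) => _ [w _ <-] /=.
by rewrite fpowersetE -fset_set_sub// => y [].
Qed.

(** * The maximal dihedral subgroup of a plane *)

Definition plane_subgroup x y : set W :=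
  generated (refl @` [set z | Phi z /\ plane x y z]).

Lemma plane_subgroup_subgroup x y : is_subgroup (plane_subgroup x y).
Proof. exact: generated_subgroup. Qed.

Lemma plane_subgroup_refl x y z : Phi z ->
  plane_subgroup x y (refl z) <-> plane x y z.
Proof.
move=> zP; split=> [|zxy]; last by apply: sub_generated; exists z.
move=> /generatedP[_ [u [uP _] <-]|s [sP zE]]; first exact: refl_sq.
have [s' [s'P sE]] := image_seq sP; apply: plane_root => //.
suff -> : refl z = refl_word s' by apply: plane_refl_word => c /s'P.
by rewrite zE sE /refl_word big_map.
Qed.

Lemma plane_subgroup_reflection x y : reflection_subgroup Delta gen (plane_subgroup x y).
Proof.
split; first exact: plane_subgroup_subgroup.
apply/seteqP; split; apply: generated_sub; try exact: generated_subgroup.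
  move=> _ [z [zP zxy] <-]; apply: sub_generated; split; last exact: refl_T.
  by apply: sub_generated; exists z.
by move=> t [].
Qed.

Lemma refl_neq1 x : Phi x -> refl x <> 1%g.
Proof.
move=> xP e; have := act_refl_self xP; rewrite e act1 => xN.
by have [h|h] := Phi_sign xP; [apply: (Phi_pos_neg h)|apply: (Phi_pos_neg h)]; rewrite /Defs.Phi_neg /= -xN.
Qed.

(** At most two canonical roots fit in a plane, by [simple_root_plane]. With a single one, a, every
    positive root of H would be proportional to a, against x <> y. *)
Lemma plane_subgroup_dihedral x y : Phi_pos x -> Phi_pos y -> x <> y ->
  dihedral_reflection_subgroup Delta gen (plane_subgroup x y).
Proof.
move=> xP yP xy; set H := plane_subgroup x y.
have HR := plane_subgroup_reflection x y; have HH := plane_subgroup_subgroup x y.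
have [xPhi yPhi] := (Phi_pos_Phi xP, Phi_pos_Phi yP).
have Hx : H (refl x) by apply/plane_subgroup_refl => //; exact: plane_l.
have Hy : H (refl y) by apply/plane_subgroup_refl => //; exact: plane_r.
have Hplane c : simple_root H c -> plane x y c.
  by move=> cH; apply/plane_subgroup_refl; [exact: simple_root_Phi cH|exact: simple_root_mem].
have [s [sH xE]] := reflection_subgroup_generated HR Hx.
have [a aH] : exists a, simple_root H a.
  case: s sH xE => [|c s] sH xE; last by exists c; apply: sH; exact: mem_head.
  by case: (refl_neq1 xPhi); rewrite xE /refl_word big_nil.
have aP := simple_root_pos aH.
have [b bH ab] : exists2 b, simple_root H b & a <> b.
  apply: contrapT => nb; have onlya c : simple_root H c -> c = a.
    by move=> cH; apply: contrapT => ca; apply: nb; exists c => // /esym.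
  have za z : Phi_pos z -> H (refl z) -> z = a.
    move=> zP /(reflection_subgroup_generated HR)[s' [s'H zE]].
    have [p [q zaE]] : plane a a z.
      apply: plane_root; first exact: Phi_pos_Phi; rewrite zE.
      apply: plane_refl_word => c /s'H cH; rewrite (onlya c cH).
      by split; [exact: Phi_pos_Phi|exact: plane_l].
    by apply: (@pos_proportional _ _ (p + q)); rewrite // scalerDl.
  by apply: xy; rewrite (za x)// (za y).
have bP := simple_root_pos bH.
apply: (@dihedral_roots_dihedral _ a b) => //; split=> //; last first.
  by move=> w; exact: reflection_subgroup_generated.
move=> c cH; apply: (simple_root_plane HH aH bH cH ab).
have [xab yab] := plane_basis aP bP ab (Hplane a aH) (Hplane b bH).
exact: plane_trans xab yab (Hplane c cH).
Qed.

(** The independent roots x and y span the plane of the canonical roots of K, so those roots, which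
    generate K, lie in the plane of x and y. *)
Lemma dihedral_sub_plane K x y : dihedral_reflection_subgroup Delta gen K ->
  Phi_pos x -> Phi_pos y -> x <> y -> K (refl x) -> K (refl y) ->
  K `<=` plane_subgroup x y.
Proof.
move=> /dihedral_reflection_subgroupP[a [b Kab]] xP yP xy Kx Ky.
have xab := dihedral_plane Kab (Phi_pos_Phi xP) Kx.
have yab := dihedral_plane Kab (Phi_pos_Phi yP) Ky.
have [axy bxy] := plane_basis xP yP xy xab yab.
case: Kab => _ _ _ Kab Kw w /Kw[s [sK ->]].
apply: subgroup_prod; first exact: plane_subgroup_subgroup.
move=> c /sK cK; apply/plane_subgroup_refl; first exact: simple_root_Phi cK.
by case: (Kab c cK) => ->.
Qed.

Lemma plane_subgroup_maximal x y : Phi_pos x -> Phi_pos y -> x <> y ->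
  maximal_dihedral Delta gen (plane_subgroup x y).
Proof.
move=> xP yP xy; split; first exact: plane_subgroup_dihedral.
move=> K Kdih HK; apply/seteqP; split => //; apply: dihedral_sub_plane => //; apply: HK.
- by apply/plane_subgroup_refl; [exact: Phi_pos_Phi|exact: plane_l].
- by apply/plane_subgroup_refl; [exact: Phi_pos_Phi|exact: plane_r].
Qed.

Lemma maximal_dihedral_plane H x y : maximal_dihedral Delta gen H ->
  Phi_pos x -> Phi_pos y -> x <> y -> H (refl x) -> H (refl y) ->
  plane_subgroup x y = H.
Proof.
move=> [Hdih Hmax] xP yP xy Hx Hy; apply: Hmax; first exact: plane_subgroup_dihedral.
exact: dihedral_sub_plane.
Qed.

(** * Dominance *)

Local Notation dom := (dominates Delta act).
Local Notation D := (D Delta act).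

Lemma dom_act x y w : dom x y -> dom (act w x) (act w y).
Proof. by move=> xy w' /=; rewrite -!actM => /(xy (w' * w)%g). Qed.

Lemma dom_opp x y : Phi x -> dom x y -> dom (- y) (- x).
Proof.
move=> xP xy w /=; rewrite !actN /Defs.Phi_neg /= !opprK => wy.
by apply: Phi_not_neg; [exact: Phi_act|move=> /xy; exact: Phi_pos_neg].
Qed.

Lemma dom_trans x y z : dom x y -> dom y z -> dom x z.
Proof. exact: subset_trans. Qed.

(** Translate x to a simple root a. The translate of y is then positive and is made negative by r_a,
    which inverts only a. *)
Lemma dom_anti x y : Phi x -> Phi y -> dom x y -> dom y x -> x = y.
Proof.
move=> [u [a [Da ->]]] yP xy yx; apply: (@act_inj u^-1%g); rewrite actK.
have := dom_act (w := u^-1%g) xy; have := dom_act (w := u^-1%g) yx; rewrite actK.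
move: (act _ y) (Phi_act u^-1%g yP) => z zP za az.
have zpos : Phi_pos z.
  apply: Phi_not_neg => // zN; have := za 1%g; rewrite /= !act1 => /(_ zN).
  exact/Phi_pos_neg/simple_pos.
apply/esym; apply: contrapT => zna; have := az (gen a).
rewrite /= act_gen_self// => /(_ (Phi_posN (simple_pos Da))).
exact/Phi_pos_neg/simple_perm.
Qed.

Lemma dom_not_opp x y : Phi x -> dom x y -> ~ dom x (- y).
Proof.
move=> xP xy xNy; have [w wx] : exists w, Phi_neg (act w x).
  have [h|h] := Phi_sign xP; last by exists 1%g; rewrite act1.
  by exists (refl x); rewrite act_refl_self//; exact: Phi_posN.
have := xNy w wx; rewrite /= actN /Defs.Phi_neg /= opprK => /Phi_pos_neg; apply.
exact: xy.
Qed.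

Lemma D_finite x : Phi_pos x -> finite_set (D x).
Proof.
move=> xP; apply: sub_finite_set (inversions_finite (refl x)) => y [yP _ xy].
split=> //; apply: (xy (refl x)) => /=.
by rewrite act_refl_self; [exact: Phi_posN|exact: Phi_pos_Phi].
Qed.

Lemma finite_roots H : finite_set H -> finite_set [set z | Phi z /\ H (refl z)].
Proof.
move=> Hfin; pose F := [set z | Phi_pos z /\ H (refl z)].
have Ffin : finite_set F.
  have inj : {in F &, injective refl}.
    by move=> y z; rewrite !inE => -[yP _] [zP _]; exact: refl_inj.
  rewrite -(eq_finite_set (inj_card_eq inj)).
  by apply: sub_finite_set Hfin => _ [z [_ Hz] <-].
apply: (@sub_finite_set _ _ (F `|` -%R @` F)); last first.
  by rewrite finite_setU; split => //; exact: finite_image.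
move=> z [zP Hz]; have [h|h] := Phi_sign zP; [by left|right].
by exists (- z); rewrite ?opprK//; split; rewrite ?reflN.
Qed.

(* If x dominates y then y dominates -r_y x, and iterating produces an
   infinite strictly descending dominance chain inside H. *)
Lemma dom_infinite H x y : is_subgroup H -> Phi x -> Phi y -> x <> y ->
  dom x y -> H (refl x) -> H (refl y) -> infinite_set H.
Proof.
move=> HH xP yP xy xdy Hx Hy /finite_roots; set F := [set z | _] => Ffin.
pose step (p : V * V) := (p.2, - act (refl p.2) p.1).
pose f k := iter k step (x, y).
have inv k : [/\ F (f k).1, F (f k).2, (f k).1 <> (f k).2 & dom (f k).1 (f k).2].
  elim: k => [|k]; first by split.
  rewrite /f iterS -/(f k) /=; case: (f k) => u v /= [[uP Hu] [vP Hv] uv udv].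
  have ruP : Phi (act (refl v) u) by exact: Phi_act.
  split => //.
  - by split; [exact: PhiN|rewrite reflN//; exact: refl_mem_act].
  - move=> e; apply: uv; apply: (@act_inj (refl v)).
    by rewrite [RHS]act_refl_self// -[LHS]opprK -e.
  - have := dom_opp ruP (dom_act (w := refl v) udv).
    by rewrite act_refl_self// opprK.
have fS k : (f k.+1).1 = (f k).2 by [].
have chain i k : dom (f i).1 (f (i + k)%N).1.
  elim: k => [|k IHk]; first by rewrite addn0; exact: subset_refl.
  rewrite addnS fS; apply: dom_trans IHk _; by have [] := inv (i + k)%N.
have chainN i j : (i < j)%N -> (f i).1 <> (f j).1.
  move=> ij e; have [[uP _] [vP _] uv udv] := inv i; apply: uv.
  apply: dom_anti => //; rewrite -fS e.
  by have := chain i.+1 (j - i.+1)%N; rewrite subnKC.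
have finj : injective (fun k => (f k).1).
  move=> i j /= e; have [ij|ji|//] := ltngtP i j.
    by case: (chainN _ _ ij).
  by case: (chainN _ _ ji).
apply: infinite_nat; rewrite (_ : setT = (fun k => (f k).1) @^-1` F).
  by apply: finite_preimage => // i j _ _; exact: finj.
by apply/seteqP; split => // k _ /=; have [] := inv k.
Qed.

Lemma PLC_root_comb x y z (p q : R) : Phi z -> z = p *: x + q *: y ->
  0 <= p -> 0 <= q -> PLC Delta x -> PLC Delta y -> PLC Delta z.
Proof.
move=> zP zE p0 q0 xP yP; have [|] := PLC_comb p0 q0 xP yP; rewrite -zE// => z0.
by have /eqP := Phi_norm zP; rewrite z0 -(scale0r 0) BZl mul0r eq_sym oner_eq0.
Qed.

Lemma neg_comb w x y z (p q : R) : Phi z -> z = p *: x + q *: y ->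
  0 <= p -> 0 <= q -> Phi_neg (act w x) -> Phi_neg (act w y) -> Phi_neg (act w z).
Proof.
move=> zP zE p0 q0 /Phi_negP[_ wx] /Phi_negP[_ wy]; apply/Phi_negP.
split; first exact: Phi_act.
apply: (PLC_root_comb (p := p) (q := q) _ _ p0 q0 wx wy); first exact/PhiN/Phi_act.
by rewrite zE act_comb combN !scaleNr !scalerN.
Qed.

(* Otherwise some w and w' send x to negative roots and a, resp. b, to positive
   ones; then w inverts the roots of H between x and b and w' those between x
   and a, so that H has finitely many roots. *)
Lemma dihedral_dom H a b x : dihedral_roots H a b -> infinite_set H ->
  Phi_pos x -> H (refl x) -> x <> a -> x <> b -> dom x a \/ dom x b.
Proof.
move=> Hab /(dihedral_infinite_roots Hab) Hinf xP Hx xa xb.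
have [_ [aH bH] _ _ _] := Hab.
have [aP bP] := (simple_root_pos aH, simple_root_pos bH).
have xPhi := Phi_pos_Phi xP.
have [l [m [l0 m0 xE]]] := dihedral_cone Hab xP Hx.
have {}l0 : 0 < l.
  rewrite lt_neqAle l0 andbT; apply/eqP => e; apply: xb.
  by apply: (pos_proportional (k := m)) => //; rewrite xE -e scale0r add0r.
have {}m0 : 0 < m.
  rewrite lt_neqAle m0 andbT; apply/eqP => e; apply: xa.
  by apply: (pos_proportional (k := l)) => //; rewrite xE -e scale0r addr0.
apply: contrapT => /not_orP[nxa nxb]; apply: Hinf.
have not_dom c : Phi c -> ~ dom x c -> exists w, Phi_neg (act w x) /\ Phi_pos (act w c).
  move=> cP nxc; apply: contrapT => nw; apply: nxc => w wx.
  apply: contrapT => wc; apply: nw; exists w; split=> //.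
  by apply: Phi_not_neg => //; exact: Phi_act.
have [w [wx wa]] := not_dom a (Phi_pos_Phi aP) nxa.
have [w' [w'x w'b]] := not_dom b (Phi_pos_Phi bP) nxb.
have wb : Phi_neg (act w b).
  have [wb|//] := Phi_sign (Phi_act w (Phi_pos_Phi bP)); exfalso.
  apply: Phi_pos_neg wx; split; first exact: Phi_act.
  apply: (PLC_root_comb (Phi_act w xPhi) _ (ltW l0) (ltW m0)).
  - by rewrite xE act_comb.
  - exact: Phi_pos_PLC.
  - exact: Phi_pos_PLC.
have w'a : Phi_neg (act w' a).
  have [w'a|//] := Phi_sign (Phi_act w' (Phi_pos_Phi aP)); exfalso.
  apply: Phi_pos_neg w'x; split; first exact: Phi_act.
  apply: (PLC_root_comb (Phi_act w' xPhi) _ (ltW l0) (ltW m0)).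
  - by rewrite xE act_comb.
  - exact: Phi_pos_PLC.
  - exact: Phi_pos_PLC.
apply: (@sub_finite_set _ _ ([set y | Phi_pos y /\ Phi_neg (act w y)] `|`
    [set y | Phi_pos y /\ Phi_neg (act w' y)])); last first.
  by rewrite finite_setU; split; exact: inversions_finite.
move=> y [yP Hy]; have yPhi := Phi_pos_Phi yP.
have [l' [m' [l'0 m'0 yE]]] := dihedral_cone Hab yP Hy.
(* Comparing the slopes m' / l' and m / l tells whether y lies between x and b or between x and
   a. *)
have [h|h] := leP (l' * m) (l * m'); [left|right]; split=> //.
  apply: (neg_comb (x := x) (y := b) (p := l' / l) (q := m' - l' / l * m)) => //.
  - rewrite xE yE combZ -addrA -scalerDl divfK ?gt_eqF//.
    by congr (_ + _ *: _); ring.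
  - by rewrite divr_ge0// ltW.
  - by rewrite subr_ge0 mulrAC ler_pdivrMr// [m' * l]mulrC.
apply: (neg_comb (x := x) (y := a) (p := m' / m) (q := l' - m' / m * l)) => //.
- rewrite xE yE combZ addrAC -scalerDl divfK ?gt_eqF//.
  by congr (_ *: _ + _); ring.
- by rewrite divr_ge0// ltW.
- by rewrite subr_ge0 mulrAC ler_pdivrMr// [m' * l]mulrC ltW.
Qed.

(** * Infinity height *)

Local Notation ncard A := (#|` fset_set A|)%fset.

Definition Drel H x : set V := [set y | D x y /\ H (refl y)].

Lemma Drel_finite H x : Phi_pos x -> finite_set (Drel H x).
Proof. by move=> xP; apply: sub_finite_set (D_finite xP) => y []. Qed.

Lemma Drel_simple H c : simple_root H c -> Drel H c = set0.
Proof.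
move=> cH; rewrite -subset0 => y [[yP yc cy] Hy].
have [cP _ cperm] := cH; apply: Phi_pos_neg (cperm y yP Hy yc) _.
by apply: cy => /=; rewrite act_refl_self; [exact: Phi_posN|exact: simple_root_Phi cH].
Qed.

Lemma Drel_refl H c x y : is_subgroup H -> simple_root H c -> y <> c ->
  Drel H x y -> Drel H (act (refl c) x) (act (refl c) y).
Proof.
move=> HH [cP Hc cperm] yc [[yP yx xy] Hy]; split.
  by split; [exact: cperm|move=> /act_inj|exact: dom_act].
by apply: refl_mem_act => //; exact: Phi_pos_Phi.
Qed.

(** A canonical root dominates no other positive root of H, so the count ends at 0. Each letter r_c
    carries the dominated roots other than c injectively to dominated roots, losing at most c. *)
Lemma card_Drel_le H x s : is_subgroup H -> (forall c, c \in s -> simple_root H c) ->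
  Phi_pos x -> H (refl x) -> simple_root H (act (refl_word s) x) ->
  ((ncard (Drel H x)) <= size s)%N.
Proof.
move=> HH; elim/last_ind: s x => [|s c IHs] x sH xP Hx.
  by rewrite /refl_word big_nil act1 => /Drel_simple->; rewrite fset_set0 cardfs0.
have cH : simple_root H c by apply: sH; rewrite mem_rcons mem_head.
(* Here r_c x is negative and the induction hypothesis does not apply, but the count is already
   0. *)
have [->|/eqP xc] := eqVneq x c.
  by rewrite (Drel_simple cH) fset_set0 cardfs0.
rewrite -cats1 refl_word_cat {2}/refl_word big_seq1 actM size_cat addn1 => xs.
have [cP Hc cperm] := cH; have x'P := cperm x xP Hx xc.
have Dfin := Drel_finite H xP.
apply: (@leq_trans ((ncard (Drel H x `\ c)).+1)).
  rewrite fset_setD1// (cardfsD1 c) -add1n leq_add2r.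
  by case: (c \in _).
rewrite ltnS; apply: (@leq_trans ((ncard (Drel H (act (refl c) x))))); last first.
  apply: IHs => //; last by apply: refl_mem_act => //; exact: Phi_pos_Phi.
  by move=> d ds; apply: sH; rewrite mem_rcons inE ds orbT.
apply: (card_fset_set_inj (@act_inj (refl c))); [|exact: Drel_finite|].
  by apply: sub_finite_set Dfin => y [].
by move=> y [yD yc]; exact: Drel_refl.
Qed.

Lemma card_Drel_word H a b x : dihedral_roots H a b -> infinite_set H ->
  Phi_pos x -> H (refl x) -> exists s,
    [/\ forall c, c \in s -> simple_root H c, simple_root H (act (refl_word s) x) &
      (size s <= (ncard (Drel H x)))%N].
Proof.
move=> Hab Hinf; have [HH [aH bH] _ _ _] := Hab.
have [n] := ubnP (ncard (Drel H x)); elim: n x => // n IHn x xn xP Hx.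
have [xa|/eqP xa] := eqVneq x a.
  by exists [::]; split; rewrite // /refl_word big_nil act1 xa.
have [xb|/eqP xb] := eqVneq x b.
  by exists [::]; split; rewrite // /refl_word big_nil act1 xb.
have [c [cH xc xdc]] : exists c, [/\ simple_root H c, x <> c & dom x c].
  by have [h|h] := dihedral_dom Hab Hinf xP Hx xa xb; [exists a|exists b].
have [cP Hc cperm] := cH; have x'P := cperm x xP Hx xc.
have [cPhi xPhi] := (Phi_pos_Phi cP, Phi_pos_Phi xP).
have Hx' : H (refl (act (refl c) x)) by exact: refl_mem_act.
have Dfin := Drel_finite H xP.
have cD : Drel H x c by split => //; split => //; exact: nesym.
have lt : ((ncard (Drel H (act (refl c) x))) < (ncard (Drel H x)))%N.
  rewrite [ltnRHS](cardfsD1 c) in_fset_set// mem_set// add1n ltnS -fset_setD1//.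
  apply: (card_fset_set_inj (@act_inj (refl c))); first exact: Drel_finite.
    by apply: sub_finite_set Dfin => y [].
  (* If r_c x dominated c, then x would dominate both c and r_c c = -c. *)
  move=> y yD; have yc : y <> c.
    move=> yc; apply: (dom_not_opp xPhi xdc).
    case: yD => -[_ _ /(dom_act (w := refl c))]; rewrite act_reflK// yc.
    by rewrite act_refl_self.
  split; first by have := Drel_refl HH cH yc yD; rewrite act_reflK.
  move=> /= e; have yE : y = - c.
    by apply: (@act_inj (refl c)); rewrite e actN act_refl_self// opprK.
  by case: yD => -[yP _ _] _; apply: Phi_pos_neg yP _; rewrite yE; exact: Phi_posN.
have [|s [sH xs sz]] := IHn _ _ x'P Hx'; first exact: leq_trans lt _.
exists (rcons s c); split.
- by move=> d; rewrite mem_rcons inE => /predU1P[->|/sH].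
- by rewrite -cats1 refl_word_cat {2}/refl_word big_seq1 actM.
- by rewrite size_rcons; exact: leq_ltn_trans lt.
Qed.

Lemma canonical_inv H t : canonical_generators Delta gen H t -> (t * t)%g = 1%g.
Proof. by move=> /canonical_generatorsP[c [/simple_root_Phi cP <-]]; exact: refl_sq. Qed.

Lemma canonical_word_length H s : (forall c, c \in s -> simple_root H c) ->
  (word_length (canonical_generators Delta gen H) (refl_word s) <= size s)%N /\
  exists s', [/\ forall c, c \in s' -> simple_root H c, refl_word s' = refl_word s &
    size s' = word_length (canonical_generators Delta gen H) (refl_word s)].
Proof.
set A := canonical_generators _ _ _ => sH.
have As : forall t, t \in map refl s -> A t.
  by move=> _ /mapP[c /sH cH ->]; apply/canonical_generatorsP; exists c.
have sE : refl_word s = (\prod_(t <- map refl s) t)%g by rewrite big_map.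
have gs : generated A (refl_word s).
  rewrite sE; apply: (subgroup_prod (f := id)); first exact: generated_subgroup.
  by move=> t /As; exact: sub_generated.
have [[r [rA rE] <-] min] := word_lengthP (@canonical_inv H) gs.
split; first by rewrite -(size_map refl s); apply: min.
have [|s' [s'H rs']] := @image_seq _ _ refl (simple_root H) r.
  by move=> t /rA/canonical_generatorsP[c [cH <-]]; exists c.
exists s'; split => //; last by rewrite rs' size_map.
by rewrite rE rs' big_map.
Qed.

Lemma height_Drel H t : maximal_dihedral Delta gen H -> infinite_set H -> H t -> T t ->
  height B Delta gen act H t = ncard (Drel H (alpha t)).
Proof.
move=> [/dihedral_reflection_subgroupP[a [b Hab]] _] Hinf Ht Tt.
have [HH _ _ _ Hw] := Hab.
have [xP xt] := alphaP Tt.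
have Hx : H (refl (alpha t)) by rewrite xt.
(* [card_Drel_le] bounds the number of letters of any word for w; it is applied to a shortest
   one. *)
have lower s : (forall c, c \in s -> simple_root H c) ->
    simple_root H (act (refl_word s) (alpha t)) ->
    (ncard (Drel H (alpha t)) <=
      word_length (canonical_generators Delta gen H) (refl_word s))%N.
  move=> sH xs; have [_ [s' [s'H e <-]]] := canonical_word_length sH.
  by apply: card_Drel_le => //; rewrite e.
apply: nat_min_eq => [|k [w [/Hw[s [sH ->]] /canonical_rootsP xs ->]]]; last exact: lower.
have [s [sH xs sz]] := card_Drel_word Hab Hinf xP Hx.
exists (refl_word s); split; [exact: refl_word_mem|exact/canonical_rootsP|].
apply/eqP; rewrite eqn_leq lower//=; apply: leq_trans sz.
by have [] := canonical_word_length sH.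
Qed.

(** The map sending y to [plane_subgroup x y] realizes the partition of D(x): its values are
    infinite by [dom_infinite] and maximal, and by [maximal_dihedral_plane] its fibre over H is
    [Drel H x]. *)
Lemma infinity_height_card t : T t ->
  infinity_height B Delta gen act t = ncard (D (alpha t)).
Proof.
move=> Tt; have [xP xt] := alphaP Tt; set x := alpha t in xP xt *.
have Dfin := D_finite xP; set s := fset_set (D x).
have inD y : y \in s -> D x y by rewrite in_fset_set// inE.
pose f := plane_subgroup x.
pose M := [set H | [/\ maximal_dihedral Delta gen H, infinite_set H & H t]].
have fM y : y \in s -> M (f y).
  move=> /inD[yP yx xy]; have [xPhi yPhi] := (Phi_pos_Phi xP, Phi_pos_Phi yP).
  have fx : f y (refl x) by apply/plane_subgroup_refl => //; exact: plane_l.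
  have fy : f y (refl y) by apply/plane_subgroup_refl => //; exact: plane_r.
  split; [exact/plane_subgroup_maximal/nesym| |by rewrite -xt].
  exact: (dom_infinite (plane_subgroup_subgroup x y) xPhi yPhi (nesym yx) xy fx fy).
have DrelE H y : M H -> Drel H x y <-> y \in s /\ f y = H.
  move=> [Hmax _ Ht]; rewrite -xt in Ht; split=> [[yD Hy]|[ys <-]].
    split; first by rewrite in_fset_set// inE.
    by case: yD => yP /nesym xy _; exact: maximal_dihedral_plane.
  split; first exact: inD.
  have [yP _ _] := inD y ys.
  by apply/plane_subgroup_refl; [exact: Phi_pos_Phi|exact: plane_r].
have heightE H : M H -> height B Delta gen act H t = count (fun y => f y == H) s.
  move=> MH; have [Hmax Hinf Ht] := MH; rewrite height_Drel// -size_filter.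
  apply: perm_size; apply: uniq_perm => [||y]; [exact: fset_uniq|exact/filter_uniq/fset_uniq|].
  rewrite in_fset_set; last exact: Drel_finite.
  rewrite mem_filter; apply/idP/idP; rewrite inE.
    by move=> /(DrelE _ _ MH)[-> ->]; rewrite eqxx.
  by move=> /andP[/eqP fy ys]; apply/DrelE.
have rM H : H \in undup (map f s) -> M H.
  by rewrite mem_undup => /mapP[y ys ->]; exact: fM.
(* The subgroups attained by [f] support the sum: over any other the fibre is empty, so the height
   is 0. *)
rewrite /infinity_height (fsbigE (undup (map f s))) ?undup_uniq//; last first.
  move=> H MH; rewrite mem_undup => /mapP nH; rewrite heightE//.
  apply/eqP; rewrite -leqn0 leqNgt -has_count; apply/hasP => -[y ys /eqP fy].
  by apply: nH; exists y.
rewrite -big_filter (_ : [seq _ <- _ | _] = undup (map f s)); last first.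
  by apply/all_filterP/allP => H /rM MH; rewrite inE.
rewrite big_seq (eq_bigr (fun H => count (fun y => f y == H) s)) => [|H /rM]; last exact: heightE.
by rewrite -big_seq sum_count_undup_map.
Qed.

End RootSystem.

Theorem theorem3p15 (R : realType) (V : lmodType R) (B : {symmetric V})
    (Delta : set V) (W : groupType) (gen : V -> W) (act : W -> V -> V)
    (hDelta : root_basis B Delta)
    (hW : coxeter_system B Delta gen)
    (hact : acts_by_reflections B Delta gen act)
    (n : nat) :
  set_bij (T_ B Delta gen act n) (D_ Delta act n) (alpha B Delta gen act).
Proof.
split=> [t [Tt <-]|t u|x [xP Dn]].
- have [xP _] := alphaP hDelta hW hact Tt; split=> //.
  rewrite (infinity_height_card hDelta hW hact Tt).
  have Dfin := D_finite hDelta hW hact xP.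
  by rewrite -{1}[D _ _ _](fset_setK Dfin); apply/card_eq_fsetP.
- rewrite !inE => -[Tt _] [Tu _] e.
  have [_ <-] := alphaP hDelta hW hact Tt; have [_ <-] := alphaP hDelta hW hact Tu.
  by rewrite e.
- have Tx := refl_T hDelta hW hact (Phi_pos_Phi xP).
  have xE := alpha_refl hDelta hW hact xP.
  exists (refl B Delta gen act x) => //; split=> //.
  by rewrite (infinity_height_card hDelta hW hact Tx) xE; exact: card_fset_set.
Qed.
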